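(* Let $p\ge2$ be an integer and $\lambda$ a partition with $p$-core $\bar\lambda$ and $p$-quotient $\mu=(\mu^0,\dots,\mu^{p-1})$, $|\mu|=\sum_i|\mu^i|$. Then $$q_\lambda(x)=x^{|\bar\lambda|}R_\lambda(x^p)$$ where $R_\lambda$ is a monic polynomial of degree $|\mu|$ with non-vanishing constant coefficient $$R_\lambda(0)=(-1)^{h_\lambda}\frac{H_{\text{non-}p\text{-fold}}(\lambda)}{H(\bar\lambda)},\qquad h_\lambda=\mathrm{ht}_p(\lambda/\bar\lambda)+\frac{|\lambda|-|\bar\lambda|}{p}.$$
   Context: Fix an integer $p\ge2$. The polynomials $q_n$ ($n\ge0$) are defined by $\sum_{n\ge0}q_n(x)t^n/n!=\exp(tx-t^p/p)$. For a partition $\lambda=(\lambda_1\ge\dots\ge\lambda_{\ell(\lambda)}>0)$ with degree vector $n_i=\lambda_i+\ell(\lambda)-i$ and $\Delta(n_\lambda)=\prod_{i<j}(n_j-n_i)$, set $q_\lambda=\mathrm{Wr}[q_{n_1},\dots,q_{n_{\ell(\lambda)}}]/\Delta(n_\lambda)$ ($q_\emptyset=1$). A border strip of size $p$ in a Young diagram is a connected skew diagram of $p$ boxes containing no $2\times2$ square; removing one must leave a Young diagram. The $p$-core $\bar\lambda$ is the partition obtained by removing border strips of size $p$ as long as possible (it is independent of choices). The height of a removed border strip is its number of rows minus one, and $\mathrm{ht}_p(\lambda/\bar\lambda)$ is the sum of the heights of the strips removed in going from $\lambda$ to $\bar\lambda$ (well defined). The $p$-quotient is the $p$-tuple of partitions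 $(\mu^0,\dots,\mu^{p-1})$ where, for a Maya diagram $M=\{m+t: m\in M_\lambda\}$ ($t\ge0$, $M_\lambda=\{n<0\}\cup\{n_1,\dots,n_{\ell(\lambda)}\}$), $\mu^i$ is the partition of the Maya diagram $\{m:pm+i\in M\}$ (the partition of a Maya diagram $N$ having as parts the positive values of $\#\{n\notin N:n<m\}$, $m\in N$); the quotient is defined up to cyclic reordering, and $|\mu|=(|\lambda|-|\bar\lambda|)/p$. $H(\lambda)$ is the product of all hook lengths of $\lambda$ and $H_{\text{non-}p\text{-fold}}(\lambda)$ the product of the hook lengths not divisible by $p$. *)

(* Defs.v *)
From mathcomp Require Import all_boot all_order all_algebra.
Set Implicit Arguments. Unset Strict Implicit. Unset Printing Implicit Defensive.
Import Order.TTheory GRing.Theory Num.Theory.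

Definition is_partition (s : seq nat) : bool :=
  sorted (fun a b => b <= a) s && all (fun x => 0 < x) s.

Definition subdiagram (nu lam : seq nat) : bool :=
  (size nu <= size lam) && all (fun i => nth 0 nu i <= nth 0 lam i) (iota 0 (size nu)).

Definition skew_cells (lam nu : seq nat) : seq (nat * nat) :=
  flatten [seq [seq (i, j) | j <- iota (nth 0 nu i) (nth 0 lam i - nth 0 nu i)]
          | i <- iota 0 (size lam)].

Definition cell_adj (a b : nat * nat) : bool :=
  ((a.1 == b.1) && ((a.2 == b.2.+1) || (b.2 == a.2.+1))) ||
  ((a.2 == b.2) && ((a.1 == b.1.+1) || (b.1 == a.1.+1))).

Definition cells_connected (c : seq (nat * nat)) : Prop :=
  forall x y, x \in c -> y \in c ->
    exists s : seq (nat * nat),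
      [/\ path cell_adj x s, last x s = y & all (fun z => z \in c) s].

Definition no_2x2 (c : seq (nat * nat)) : Prop :=
  forall i j : nat, ~~ [&& (i, j) \in c, (i.+1, j) \in c, (i, j.+1) \in c & (i.+1, j.+1) \in c].

Definition border_strip (p : nat) (lam nu : seq nat) : Prop :=
  [/\ is_partition lam, is_partition nu, subdiagram nu lam,
      size (skew_cells lam nu) = p &
      cells_connected (skew_cells lam nu) /\ no_2x2 (skew_cells lam nu)].

Definition strip_height (lam nu : seq nat) : nat :=
  (size (undup (map fst (skew_cells lam nu)))).-1.

Inductive strip_chain (p : nat) : seq nat -> seq nat -> nat -> Prop :=
| sc_nil lam : strip_chain p lam lam 0
| sc_cons lam nu core h :
    border_strip p lam nu -> strip_chain p nu core h ->
    strip_chain p lam core (strip_height lam nu + h).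

Definition conj_part (lam : seq nat) (j : nat) : nat := count (fun x => j < x) lam.

Definition hook (lam : seq nat) (i j : nat) : nat :=
  (nth 0 lam i - j) + (conj_part lam j - i) - 1.

Definition cells (lam : seq nat) : seq (nat * nat) := skew_cells lam [::].

Definition hook_prod (lam : seq nat) : nat :=
  \prod_(c <- cells lam) hook lam c.1 c.2.

Definition hook_prod_nonp (p : nat) (lam : seq nat) : nat :=
  \prod_(c <- cells lam | ~~ (p %| hook lam c.1 c.2)) hook lam c.1 c.2.

(* n_i = lambda_i + l(lambda) - i  (1-indexed), here 0-indexed. *)
Definition degvec (lam : seq nat) : seq nat :=
  [seq nth 0 lam i + (size lam - i.+1) | i <- iota 0 (size lam)].

Local Open Scope ring_scope.

(* M_lambda = {n < 0} U {n_1, ..., n_l}  (shift t = 0). *)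
Definition maya_lam (lam : seq nat) (m : int) : bool :=
  (m < 0) || (m \in [seq (n%:Z) | n <- degvec lam]).

Definition rng (B : nat) : seq int := [seq (k%:Z - B%:Z) | k <- iota 0 (2 * B)].

(* Partition of a Maya diagram N, restricted to a window [-B, B) that contains
   all its relevant elements and gaps: parts are the positive values of
   #{n notin N : n < m}, m in N. *)
Definition maya_part (N : int -> bool) (B : nat) : seq nat :=
  sort (fun a b => b <= a)%N
    (filter (fun k => 0 < k)%N
       [seq count (fun n => ~~ N n && (n < m)) (rng B) | m <- rng B & N m]).

(* The p-quotient (mu^0, ..., mu^{p-1}); mu^i is the partition of the Maya
   diagram {m : p m + i in M_lambda}.  The window bound below is large enough. *)
Definition p_quotient (p : nat) (lam : seq nat) : seq (seq nat) :=
  [seq maya_part (fun m => maya_lam lam ((p%:Z) * m + (i%:Z))) (sumn lam + size lam).+1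
  | i <- iota 0 p].

Definition quot_size (p : nat) (lam : seq nat) : nat := sumn (map sumn (p_quotient p lam)).

(* Coefficients of t^n/n! in exp(t x - t^p/p):
   q_n(x) = sum_{k <= n/p} n! / (k! (n - p k)!) (-1/p)^k x^(n - p k). *)
Definition qpoly (p n : nat) : {poly rat} :=
  \sum_(k < (n %/ p).+1)
    (((n`!)%:R / ((k`!)%:R * ((n - p * k)`!)%:R)) * (- (p%:R)^-1) ^+ k) *: 'X^(n - p * k).

Definition Delta (ns : seq nat) : rat :=
  \prod_(i < size ns) \prod_(j < size ns | (i < j)%N)
     (((nth 0 ns j)%:Z - (nth 0 ns i)%:Z)%:~R).

Definition wronskian (fs : seq {poly rat}) : {poly rat} :=
  \det (\matrix_(i < size fs, j < size fs) (nth 0 fs j)^`(i)).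

Definition q_lam (p : nat) (lam : seq nat) : {poly rat} :=
  (Delta (degvec lam))^-1 *: wronskian [seq qpoly p n | n <- degvec lam].

(* Main.v *)
Require Import Defs.
From mathcomp Require Import all_boot all_order all_fingroup all_algebra.
From mathcomp Require Import zify ring.
Set Implicit Arguments. Unset Strict Implicit. Unset Printing Implicit Defensive.
Import Order.TTheory GRing.Theory Num.Theory.
Local Open Scope ring_scope.

(** Write [n_j] for the degree vector.  Expanding each [q_(n_j)] in monomials inside the Wronskian
    gives a sum, over tuples [k], of Vandermonde products in the numbers [m_j = n_j - p k_j], times
    [x^(|lambda| - p sum k)].  A term survives only if the [m_j] are distinct; since [m_j] has the
    same residue mod [p] as [n_j], the sum of the [m_j] is then at least that of the beta-set of
    the [p]-core, with equality only if the [m_j] are a permutation of it.  This gives the factor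
    [x^|core|], and the constant coefficient of [R] becomes the Vandermonde product of the core
    times a determinant with entries [1/(q_j - a_i)!] for equal residues ([q_j = n_j %/ p]) and 0
    otherwise.  That determinant is evaluated by Newton interpolation, runner by runner, and the
    products [n!/Vandermonde] are hook products.  Removing a border strip of size [p] slides one
    bead from [n] to [n - p], past as many beads as the height of the strip; this changes the
    parity of the number of pairs of beads that are inverted with respect to (residue, value) by
    the height, whence the sign. *)

(** * Wronskians and Newton determinants *)

(** The position of [j] among the indices of its class. With residues as classes it is both the
    degree of a Newton basis polynomial and the level of a bead in the core. *)
Definition occ (T : eqType) (cl : nat -> T) (j : nat) : nat :=
  count (fun i => cl i == cl j) (iota 0 j).

Lemma occ_lt (T : eqType) (cl : nat -> T) (i j : nat) :
  (i < j)%N -> cl i = cl j -> (occ cl i < occ cl j)%N.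
Proof.
move=> ij e; rewrite /occ e.
have {3}-> : j = (i + (1 + (j - i.+1)))%N by lia.
by rewrite iotaD count_cat /= add0n e eqxx addnS ltnS leq_addr.
Qed.

(** Induction on [l]: as a function of the last node, the determinant is a polynomial of degree at
    most [occ cl l] that vanishes at the earlier nodes of its class, and its coefficient in that
    degree is the smaller determinant. Classes allow a block determinant to be evaluated without
    reordering its indices. *)
Lemma det_newton (T : eqType) (F : fieldType) (cl : nat -> T) (q : nat -> F)
    (P : nat -> {poly F}) (l : nat) :
  (forall k, P k \is monic) -> (forall k, size (P k) = k.+1) ->
  (forall i j, (i < l)%N -> (j < l)%N -> cl i = cl j -> q i = q j -> i = j) ->
  \det (\matrix_(i < l, j < l)
          (if cl i == cl j then (P (occ cl i)).[q j] else 0))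
  = \prod_(j < l) \prod_(i < j | cl i == cl j) (q j - q i).
Proof.
move=> Pm Ps; elim: l => [|l IH] inj; first by rewrite det_mx00 big_ord0.
rewrite big_ord_recr /= -IH; last by move=> i j il jl; apply: inj; apply: ltnW.
set M := (X in \det X = _); set M0 := (X in _ = \det X * _).
pose c (i : 'I_l.+1) := cofactor M i ord_max.
(* [f] is the expansion along the last column with the node [q l] replaced by the indeterminate. *)
pose f := \sum_(i < l.+1) c i *: (if cl i == cl l then P (occ cl i) else 0).
have cM : c ord_max = \det M0.
  rewrite /c /cofactor /= -signr_odd oddD addbb expr0 mul1r; congr (\det _).
  by apply/matrixP=> i j; rewrite !mxE !lift_max.
have fM t : f.[t] = \sum_(i < l.+1) (if cl i == cl l then (P (occ cl i)).[t] else 0) * c i.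
  rewrite horner_sum; apply: eq_bigr => i _; rewrite hornerZ mulrC.
  by case: ifP; rewrite ?horner0.
have fdet : f.[q l] = \det M.
  rewrite fM (expand_det_col M ord_max); apply: eq_bigr => i _.
  by rewrite [M i _]mxE.
have froot (i0 : 'I_l.+1) : (i0 < l)%N -> cl i0 = cl l -> f.[q i0] = 0.
  (* Evaluation at an earlier node of the class makes the last column equal to column [i0]. *)
  move=> i0l e; pose M' := \matrix_(i < l.+1, j < l.+1)
    (if j == ord_max then if cl i == cl l then (P (occ cl i)).[q i0] else 0 else M i j).
  rewrite fM; transitivity (\det M').
    rewrite (expand_det_col M' ord_max); apply: eq_bigr => i _.
    rewrite [M' i _]mxE eqxx; congr (_ * _); rewrite /c /cofactor; congr (_ * \det _).
    apply/matrixP=> u v; rewrite [in RHS]mxE [in LHS]mxE [in RHS]mxE [in LHS]mxE.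
    rewrite [in RHS]mxE; case: eqP => // E.
    by have := neq_lift ord_max v; rewrite E eqxx.
  rewrite -det_tr (determinant_alternate (i1 := i0) (i2 := ord_max)) //.
    by apply/eqP => /(congr1 val) /= E; rewrite E ltnn in i0l.
  move=> u; rewrite !mxE eqxx; case: eqP => // _; by rewrite e.
pose rs := [seq q i | i <- iota 0 l & cl i == cl l].
pose g := \prod_(z <- rs) ('X - z%:P).
have srs : size rs = occ cl l by rewrite size_map size_filter.
have gsz : size g = (occ cl l).+1 by rewrite size_prod_XsubC srs.
have gm : g \is monic by apply: monic_prod_XsubC.
have fg : f = c ord_max *: g.
  apply/eqP; rewrite -subr_eq0; apply/eqP.
  apply: (@roots_geq_poly_eq0 _ _ rs).
  - apply/allP => z /mapP[i]; rewrite mem_filter mem_iota /= add0n => /andP[/eqP e il] ->.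
    rewrite rootE !hornerE (froot (Ordinal (leqW il))) //.
    suff: root g (q i) by move=> /rootP ->; rewrite mulr0 subr0.
    by rewrite root_prod_XsubC; apply: map_f; rewrite mem_filter e eqxx mem_iota.
  - rewrite map_inj_in_uniq ?filter_uniq ?iota_uniq // => i j.
    rewrite !mem_filter !mem_iota /= !add0n => /andP[/eqP e1 l1] /andP[/eqP e2 l2].
    by apply: inj; rewrite ?e1 ?e2 // leqW.
  (* The monic terms of degree [occ cl l] cancel, so the difference has degree below the number of
     its distinct roots. *)
  rewrite srs /f big_ord_recr /= eqxx -addrA -scalerBr.
  apply: (leq_trans (size_polyD _ _)); rewrite geq_max; apply/andP; split.
    apply: (leq_trans (size_sum _ _ _)); apply/bigmax_leqP => i _ /=.
    apply: leq_trans (size_scale_leq _ _) _; case: eqP => e; last by rewrite size_poly0.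
    by rewrite Ps; apply: occ_lt.
  apply: leq_trans (size_scale_leq _ _) _; apply/leq_sizeP => k; rewrite coefB.
  rewrite leq_eqVlt => /predU1P[<-|lk]; last by rewrite !nth_default ?subrr ?Ps ?gsz.
  have := monicP (Pm (occ cl l)); have := monicP gm.
  by rewrite !lead_coefE Ps gsz /= => -> ->; rewrite subrr.
rewrite -fdet fg hornerZ cM horner_prod big_map big_filter /=; congr (_ * _).
rewrite -{1}(subn0 l) big_mkord.
by apply: eq_bigr => i _; rewrite !hornerE.
Qed.

Definition ffact_poly (k : nat) : {poly rat} := \prod_(u < k) ('X - (u%:R)%:P).

Lemma ffact_poly_monic k : ffact_poly k \is monic.
Proof. exact: monic_prod_XsubC. Qed.

Lemma size_ffact_poly k : size (ffact_poly k) = k.+1.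
Proof. by rewrite size_prod_XsubC /index_enum -enumT size_enum_ord. Qed.

Lemma horner_ffact_poly k m : (ffact_poly k).[m%:R] = (m ^_ k)%:R.
Proof.
rewrite horner_prod; elim: k => [|k IH]; first by rewrite big_ord0.
rewrite big_ord_recr /= IH ffactnSr natrM !hornerE.
have [km|mk] := leqP k m; first by rewrite natrB.
by rewrite ffact_small ?mul0r.
Qed.

Definition vdm (l : nat) (m : nat -> nat) : rat :=
  \prod_(j < l) \prod_(i < j) ((m j)%:R - (m i)%:R).

Lemma vdm_eq l m m' : (forall j, (j < l)%N -> m j = m' j) -> vdm l m = vdm l m'.
Proof.
move=> e; apply: eq_bigr => j _; apply: eq_bigr => i _.
by rewrite !e // (ltn_trans (ltn_ord i)).
Qed.

Lemma vdm_eq0 l m : (vdm l m == 0) = [exists j : 'I_l, [exists i : 'I_l, (i < j)%N && (m i == m j)]].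
Proof.
apply/idP/existsP => [|[j /existsP[i /andP[ij /eqP e]]]].
  move=> /prodf_eq0[j _ /prodf_eq0[i _]].
  rewrite subr_eq0 eqr_nat eq_sym => e; exists j; apply/existsP.
  by exists (Ordinal (ltn_trans (ltn_ord i) (ltn_ord j))); rewrite /= ltn_ord.
by apply/prodf_eq0; exists j => //; apply/prodf_eq0; exists (Ordinal ij); rewrite //= e subrr.
Qed.

Lemma vdm_neq0P l m :
  reflect (forall i j, (i < l)%N -> (j < l)%N -> m i = m j -> i = j) (vdm l m != 0).
Proof.
apply: (iffP idP) => [|inj]; rewrite vdm_eq0.
  rewrite negb_exists => /forallP H i j il jl e.
  wlog ij : i j il jl e / (i < j)%N.
    by move=> W; case: (ltngtP i j) => // ij; [exact: W|symmetry; exact: W].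
  have := H (Ordinal jl); rewrite negb_exists => /forallP/(_ (Ordinal il)).
  by rewrite /= ij e eqxx.
apply/negP => /existsP[j /existsP[i /andP[ij /eqP e]]].
by rewrite (inj i j) ?ltnn in ij.
Qed.

Lemma occ_const j : occ (fun=> tt) j = j.
Proof. by rewrite /occ (eq_count (a2 := predT)) // count_predT size_iota. Qed.

Lemma det_ffact l (m : nat -> nat) :
  \det (\matrix_(i < l, j < l) ((m j) ^_ i)%:R) = vdm l m.
Proof.
have [z|/vdm_neq0P inj] := eqVneq (vdm l m) 0.
  rewrite z; move/eqP: z; rewrite vdm_eq0 => /existsP[j /existsP[i /andP[ij /eqP e]]].
  rewrite -det_tr (determinant_alternate (i1 := i) (i2 := j)) //.
    by apply/eqP => E; rewrite E ltnn in ij.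
  by move=> u; rewrite !mxE e.
rewrite /vdm -(@det_newton _ _ (fun=> tt) (fun i => (m i)%:R) ffact_poly).
- congr (\det _); apply/matrixP => i j.
  by rewrite !mxE eqxx occ_const horner_ffact_poly.
- exact: ffact_poly_monic.
- exact: size_ffact_poly.
by move=> i j il jl _ /eqP; rewrite eqr_nat => /eqP; apply: inj.
Qed.

Lemma wronskian_monomials l (m : nat -> nat) :
  \det (\matrix_(i < l, j < l) ('X^(m j) : {poly rat})^`(i))
  = vdm l m *: 'X^(\sum_(j < l) m j - \sum_(j < l) j).
Proof.
rewrite -det_ffact -[in LHS]det_tr -[X in _ = X *: _]det_tr /determinant scaler_suml.
apply: eq_bigr => s _.
have -> : \prod_(i < l) ((\matrix_(i < l, j < l) ('X^(m j) : {poly rat})^`(i))^T i (s i))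
  = (\prod_(i < l) ((m i) ^_ (s i))%:R) *: 'X^(\sum_(i < l) (m i - s i)).
  rewrite -prodrXr -scaler_prod; apply: eq_bigr => i _.
  by rewrite !mxE derivnXn scaler_nat.
have -> : \prod_(i < l) ((\matrix_(i < l, j < l) ((m j) ^_ i)%:R)^T i (s i))
  = \prod_(i < l) ((m i) ^_ (s i))%:R :> rat.
  by apply: eq_bigr => i _; rewrite !mxE.
have sgnZ (b : bool) (p : {poly rat}) : (-1) ^+ b * p = ((-1) ^+ b) *: p.
  by case: b; rewrite ?expr0 ?expr1 ?mul1r ?scale1r ?mulN1r ?scaleN1r.
rewrite sgnZ scalerA.
(* An exponent truncated because [m i < s i] comes with a vanishing falling factorial, so all
   surviving terms carry the same power of ['X]. *)
have [/existsP[i ms]|/existsPn ms] := boolP [exists i : 'I_l, (m i < s i)%N].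
  by rewrite [\prod__ _](bigD1 i) //= ffact_small // mul0r mulr0 !scale0r.
congr (_ *: 'X^_).
rewrite sumnB => [|i _]; last by rewrite leqNgt ms.
by congr (_ - _)%N; rewrite [RHS](reindex_inj (@perm_inj _ s)).
Qed.

Lemma det_sum_cols (R : comNzRingType) l (K : finType) (c : 'I_l -> K -> R)
    (F : 'I_l -> K -> 'I_l -> R) :
  \det (\matrix_(i < l, j < l) \sum_k c j k * F j k i)
  = \sum_(f : {ffun 'I_l -> K})
      (\prod_j c j (f j)) * \det (\matrix_(i < l, j < l) F j (f j) i).
Proof.
rewrite -[LHS]det_tr [LHS]/determinant.
under eq_bigr => s _.
  under eq_bigr => j _ do rewrite !mxE.
  rewrite bigA_distr_bigA mulr_sumr; over.
rewrite exchange_big; apply: eq_bigr => f _ /=.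
rewrite -[\det _]det_tr /determinant mulr_sumr; apply: eq_bigr => s _.
rewrite big_split /= mulrCA; congr (_ * (_ * _)); apply: eq_bigr => i _.
by rewrite !mxE.
Qed.

(** Extended by 0 beyond [p * k <= m], so that the expansions of all columns can share one range
    [k < K]. *)
Definition alpha (p m k : nat) : rat :=
  if (p * k <= m)%N then
    ((m`!)%:R / ((k`!)%:R * ((m - p * k)`!)%:R)) * (- (p%:R)^-1) ^+ k
  else 0.

Lemma qpoly_alpha p m K : (0 < p)%N -> (m %/ p < K)%N ->
  Defs.qpoly p m = \sum_(k < K) alpha p m k *: 'X^(m - p * k).
Proof.
move=> p0 mK; rewrite /Defs.qpoly (big_ord_widen K (fun k =>
  ((m`!)%:R / ((k`!)%:R * ((m - p * k)`!)%:R) * (- (p%:R)^-1) ^+ k) *: 'X^(m - p * k))) //.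
rewrite big_mkcond /=; apply: eq_bigr => k _.
rewrite /alpha ltnS leq_divRL // mulnC; by case: ifP => // _; rewrite scale0r.
Qed.

(** Lets a tuple on ['I_l] serve as the nodes of [vdm], which are indexed by all of [nat]. *)
Definition extend l (f : 'I_l -> nat) (j : nat) : nat := oapp f 0%N (insub j).

Lemma extend_ord l (f : 'I_l -> nat) (j : 'I_l) : extend f j = f j.
Proof. by rewrite /extend valK. Qed.

Lemma wronskian_expand p l K (n : nat -> nat) :
  (0 < p)%N -> (forall j, (j < l)%N -> (n j %/ p < K)%N) ->
  \det (\matrix_(i < l, j < l) (Defs.qpoly p (n j))^`(i))
  = \sum_(k : {ffun 'I_l -> 'I_K})
     (\prod_(j < l) alpha p (n j) (k j) * vdm l (extend (fun j : 'I_l => n j - p * k j)%N))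
     *: 'X^(\sum_(j < l) (n j - p * k j) - \sum_(j < l) j).
Proof.
move=> p0 nK.
have -> : \matrix_(i < l, j < l) (Defs.qpoly p (n j))^`(i)
   = \matrix_(i < l, j < l) \sum_(k < K) (alpha p (n j) k)%:P * ('X^(n j - p * k))^`(i).
  apply/matrixP => i j; rewrite !mxE (qpoly_alpha p0 (nK _ (ltn_ord j))) linear_sum.
  by apply: eq_bigr => k _; rewrite /= derivnZ mul_polyC.
rewrite (det_sum_cols (fun j (k : 'I_K) => (alpha p (n j) k)%:P)
   (fun j (k : 'I_K) i => ('X^(n j - p * k))^`(i))).
apply: eq_bigr => k _; rewrite -rmorph_prod mul_polyC -scalerA; congr (_ *: _).
set f := fun j : 'I_l => (_ - _)%N.
transitivity (\det (\matrix_(i < l, j < l) ('X^(extend f j) : {poly rat})^`(i))).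
  by congr (\det _); apply/matrixP => i j; rewrite !mxE extend_ord.
rewrite wronskian_monomials; congr (_ *: 'X^(_ - _)).
by apply: eq_bigr => j _; rewrite extend_ord.
Qed.

(** * The beta-set of the core minimizes the sum *)

Lemma count_iota (P : pred nat) l : count P (iota 0 l) = (\sum_(i < l) P i)%N.
Proof.
by rewrite -sum1_count big_mkcond /= -{1}(subn0 l) big_mkord; apply: eq_bigr => i _; case: (P i).
Qed.

(** Pairs each off-diagonal entry with its mirror image; this trades sums and products over ordered
    pairs for ones over [i < j]. *)
Lemma big_square (R : Type) (idx : R) (op : Monoid.com_law idx) (G : nat -> nat -> R) l :
  \big[op/idx]_(j < l) \big[op/idx]_(i < l) G i j
  = op (\big[op/idx]_(j < l) \big[op/idx]_(i < j) op (G i j) (G j i))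
       (\big[op/idx]_(j < l) G j j).
Proof.
elim: l => [|l IH]; first by rewrite !big_ord0 Monoid.mulm1.
rewrite !big_ord_recr /=.
under eq_bigr => j _ do rewrite big_ord_recr /=.
rewrite !big_split /= IH -!Monoid.mulmA; congr (op _ _).
set D := \big[op/idx]_(i < l) G i i; set r := \big[op/idx]_(i < l) G l i.
by rewrite [LHS]Monoid.mulmCA [RHS]Monoid.mulmCA; congr (op _ _); rewrite [LHS]Monoid.mulmCA.
Qed.

Definition rank (T : eqType) (cl : nat -> T) (b : nat -> nat) (l j : nat) : nat :=
  count (fun i => (cl i == cl j) && (b i < b j)%N) (iota 0 l).

Lemma rank_le (T : eqType) (cl : nat -> T) (b : nat -> nat) l j :
  (forall i j, (i < l)%N -> (j < l)%N -> cl i = cl j -> b i = b j -> i = j) ->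
  (rank cl b l j <= b j)%N.
Proof.
move=> inj; rewrite /rank -size_filter -(size_map b) -[X in (_ <= X)%N](size_iota 0).
apply: uniq_leq_size.
  rewrite map_inj_in_uniq ?filter_uniq ?iota_uniq // => u v.
  rewrite !mem_filter !mem_iota /= !add0n => /andP[/andP[/eqP e1 _] l1] /andP[/andP[/eqP e2 _] l2].
  by apply: inj; rewrite ?e1 ?e2.
move=> x /mapP[i]; rewrite mem_filter => /andP[/andP[_ h] _] ->.
by rewrite mem_iota add0n.
Qed.

(** Both sums count the unordered pairs inside a class: [occ] charges a pair to the larger index,
    [rank] to the larger value. *)
Lemma sum_rank (T : eqType) (cl : nat -> T) (b : nat -> nat) l :
  (forall i j, (i < l)%N -> (j < l)%N -> cl i = cl j -> b i = b j -> i = j) ->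
  (\sum_(j < l) rank cl b l j = \sum_(j < l) occ cl j)%N.
Proof.
move=> inj; under eq_bigr => j _ do rewrite /rank count_iota.
rewrite (big_square addn (fun i j => nat_of_bool ((cl i == cl j) && (b i < b j)%N))) /=.
rewrite [X in (_ + X)%N]big1 /= ?addn0 => [|j _]; last by rewrite ltnn andbF.
apply: eq_bigr => j _; rewrite /occ count_iota; apply: eq_bigr => i _.
rewrite [cl j == _]eq_sym; case: eqP => //= e; case: ltngtP => // e2.
have il := ltn_trans (ltn_ord i) (ltn_ord j).
by have := inj i j il (ltn_ord j) e e2; have := ltn_ord i; lia.
Qed.

Lemma sum_occ_le (T : eqType) (cl : nat -> T) (b : nat -> nat) l :
  (forall i j, (i < l)%N -> (j < l)%N -> cl i = cl j -> b i = b j -> i = j) ->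
  (\sum_(j < l) occ cl j <= \sum_(j < l) b j)%N.
Proof.
by move=> inj; rewrite -(sum_rank inj); apply: leq_sum => j _; apply: rank_le.
Qed.

Lemma occ_onto (T : eqType) (cl : nat -> T) l c a :
  (a < count (fun i => cl i == c) (iota 0 l))%N ->
  exists j, [/\ (j < l)%N, cl j = c & occ cl j = a].
Proof.
elim: l => [//|l IH]; rewrite -{1}[l.+1]addn1 iotaD count_cat /= add0n addn0 => h.
have [h2|h2] := ltnP a (count (fun i => cl i == c) (iota 0 l)).
  by have [j [jl e1 e2]] := IH h2; exists j; split => //; rewrite ltnW // ltnS.
move: h; case: eqP => [e|_]; last by rewrite addn0 ltnNge h2.
rewrite addn1 ltnS => h; exists l; split => //.
by rewrite /occ e; apply/eqP; rewrite eqn_leq h h2.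
Qed.

(* The beta-set of the [p]-core, indexed by the beads of [n]: on each runner the beads are
   pushed down, in order of index. *)
Definition core_bead (p : nat) (n : nat -> nat) (j : nat) : nat :=
  (p * occ (fun i => n i %% p) j + n j %% p)%N.

Lemma core_bead_mod p n j : (0 < p)%N -> (core_bead p n j %% p = n j %% p)%N.
Proof. by move=> p0; rewrite /core_bead mulnC modnMDl modn_mod. Qed.

Lemma core_bead_div p n j : (0 < p)%N -> (core_bead p n j %/ p)%N = occ (fun i => n i %% p)%N j.
Proof. by move=> p0; rewrite /core_bead mulnC divnMDl // divn_small ?addn0 // ltn_mod. Qed.

Lemma core_bead_inj p n : (0 < p)%N -> injective (core_bead p n).
Proof.
move=> p0 i j e.
have e1 : (n i %% p = n j %% p)%N by rewrite -(core_bead_mod n i p0) e core_bead_mod.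
have e2 : occ (fun i => n i %% p)%N i = occ (fun i => n i %% p)%N j by rewrite -(core_bead_div n i p0) e core_bead_div.
case: (ltngtP i j) => // ij.
  by have := @occ_lt _ (fun i => n i %% p)%N _ _ ij e1; rewrite e2 ltnn.
by have := @occ_lt _ (fun i => n i %% p)%N _ _ ij (esym e1); rewrite e2 ltnn.
Qed.

Lemma core_bead_onto p n l m : (0 < p)%N ->
  (m %/ p < count (fun i => n i %% p == m %% p) (iota 0 l))%N ->
  exists2 j, (j < l)%N & core_bead p n j = m.
Proof.
move=> p0 /(@occ_onto _ (fun i => n i %% p)%N)[j [jl e1 e2]]; exists j => //.
by rewrite /core_bead e1 e2 mulnC -divn_eq.
Qed.

Lemma sum_core_bead p n l : (\sum_(j < l) core_bead p n j
  = p * \sum_(j < l) occ (fun i => n i %% p) j + \sum_(j < l) n j %% p)%N.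
Proof. by rewrite big_split /= big_distrr. Qed.

Lemma sum_divn_modn p (n : nat -> nat) l : (\sum_(j < l) n j = p * \sum_(j < l) n j %/ p + \sum_(j < l) n j %% p)%N.
Proof. by rewrite big_distrr -big_split; apply: eq_bigr => j _ /=; rewrite mulnC -divn_eq. Qed.

Lemma div_inj p (n m : nat -> nat) l : (forall j, (j < l)%N -> m j %% p = n j %% p)%N ->
  (forall i j, (i < l)%N -> (j < l)%N -> m i = m j -> i = j) ->
  forall i j, (i < l)%N -> (j < l)%N -> (n i %% p = n j %% p)%N -> (m i %/ p = m j %/ p)%N -> i = j.
Proof.
move=> e inj i j il jl e1 e2; apply: inj => //.
by rewrite (divn_eq (m i) p) (divn_eq (m j) p) e2 !e // e1.
Qed.

(** With the residues fixed only the levels vary, and [c] distinct levels on one runner sum to at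
    least [0 + ... + (c - 1)]. *)
Lemma core_bead_min p (n m : nat -> nat) l : (0 < p)%N -> (forall j, (j < l)%N -> m j %% p = n j %% p)%N ->
  (forall i j, (i < l)%N -> (j < l)%N -> m i = m j -> i = j) ->
  (\sum_(j < l) core_bead p n j <= \sum_(j < l) m j)%N.
Proof.
move=> p0 e inj; rewrite sum_core_bead (sum_divn_modn p m).
rewrite leq_add ?leq_mul2l ?(sum_occ_le (div_inj e inj)) ?orbT //.
by apply: leq_sum => j _; rewrite e.
Qed.

(** Equality forces the level of every bead to be its rank, so each runner is filled from the
    bottom; injectivity then turns the matching with core beads into a permutation. *)
Lemma core_bead_min_eq p (n m : nat -> nat) l : (0 < p)%N -> (forall j, (j < l)%N -> m j %% p = n j %% p)%N ->
  (forall i j, (i < l)%N -> (j < l)%N -> m i = m j -> i = j) ->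
  (\sum_(j < l) core_bead p n j = \sum_(j < l) m j)%N ->
  exists s : 'S_l, forall j : 'I_l, m j = core_bead p n (s j).
Proof.
move=> p0 e inj; rewrite sum_core_bead (sum_divn_modn p m).
have -> : (\sum_(j < l) m j %% p = \sum_(j < l) n j %% p)%N by apply: eq_bigr => j _; rewrite e.
move=> /addIn /eqP; rewrite eqn_pmul2l // => /eqP se.
set cl := fun i => (n i %% p)%N in se; pose b i := (m i %/ p)%N.
have binj := div_inj e inj.
have rb (j : 'I_l) : rank cl b l j = b j.
  have H (i : 'I_l) : true -> (rank cl b l i <= b i ?= iff (rank cl b l i == b i))%N.
    by move=> _; split => //; apply: rank_le.
  have [_] := leqif_sum H; rewrite (sum_rank binj) se eqxx => /esym/forallP/(_ j).
  by move/eqP.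
have ex (j : 'I_l) : exists i : 'I_l, m j == core_bead p n i.
  have [|i il <-] := @core_bead_onto p n l (m j) p0; last by exists (Ordinal il).
  (* The level of [m j] counts the lower beads of its runner; the bead itself is one more, so this
     level is below the number of beads there. *)
  rewrite -[(_ %/ _)%N]/(b j) -rb /rank !count_iota e //.
  rewrite (bigD1 j) //= [X in (_ < X)%N](bigD1 j) //= !eqxx ltnn andbF add0n add1n ltnS.
  by apply: leq_sum => i _; case: eqP => //= _; case: ltngtP.
pose f j := xchoose (ex j).
have fE (j : 'I_l) : m j = core_bead p n (f j) by apply/eqP; apply: (xchooseP (ex j)).
have finj : injective f.
  by move=> i j eq; apply/ord_inj; apply: inj => //; rewrite !fE eq.
by exists (perm finj) => j; rewrite permE.
Qed.

(** * The polynomial R and its constant coefficient *)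

Lemma vdm_perm l (C : nat -> nat) (s : 'S_l) :
  vdm l (extend (fun j => C (s j))) = (-1) ^+ s * vdm l C.
Proof.
rewrite -!det_ffact mulrC.
have -> : \matrix_(i < l, j < l) ((extend (fun k : 'I_l => C (s k)) j) ^_ i)%:R
        = col_perm s (\matrix_(i < l, j < l) ((C j) ^_ i)%:R) :> 'M[rat]_l.
  by apply/matrixP => i j; rewrite !mxE extend_ord.
by rewrite col_permE det_mulmx det_perm odd_permV.
Qed.

Definition nonp_fact (p m : nat) : nat := \prod_(1 <= h < m.+1 | ~~ (p %| h)%N) h.

Lemma nonp_factS p m :
  nonp_fact p m.+1 = (nonp_fact p m * (if p %| m.+1 then 1 else m.+1))%N.
Proof.
rewrite /nonp_fact big_mkcond big_nat_recr //= -big_mkcond /=.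
by case: (p %| m.+1)%N.
Qed.

(** The multiples of [p] up to [m] are [p] times [1, ..., m %/ p]. *)
Lemma fact_nonp p m : (0 < p)%N ->
  (m`! = nonp_fact p m * (p ^ (m %/ p) * (m %/ p)`!))%N.
Proof.
move=> p0; elim: m => [|m IH].
  by rewrite div0n /nonp_fact big_nil.
rewrite factS IH nonp_factS divnS //.
case: (boolP (p %| m.+1)%N) => [d|_]; last by rewrite add0n; ring.
have e : (m.+1 = p * (m %/ p).+1)%N by rewrite -{1}(divnK d) divnS // d add1n mulnC.
rewrite {1}e add1n expnS factS muln1; ring.
Qed.

Definition Rcoef p l K (n : nat -> nat) (k : {ffun 'I_l -> 'I_K}) : rat :=
  \prod_(j < l) alpha p (n j) (k j) * vdm l (extend (fun j : 'I_l => n j - p * k j)%N).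

(** The number of elementary slides by [p] that push all beads down to the core; [sum_occ_le] shows
    that the subtraction is not truncated when the [n j] are distinct. *)
Definition Rdeg p l (n : nat -> nat) : nat :=
  \sum_(j < l) n j %/ p - \sum_(j < l) occ (fun i => n i %% p)%N j.

(** By [Rcoef_deg], a tuple whose exponent would be truncated has coefficient 0. *)
Definition Rpoly p l K (n : nat -> nat) : {poly rat} :=
  \sum_(k : {ffun 'I_l -> 'I_K})
     ((vdm l n)^-1 * Rcoef p n k) *: 'X^(Rdeg p l n - \sum_j k j).

Lemma alpha_neq0 p m k : (0 < p)%N -> (alpha p m k != 0) = (p * k <= m)%N.
Proof.
move=> p0; rewrite /alpha; case: ifP; rewrite ?eqxx // => _.
rewrite !(mulf_neq0, invr_neq0) ?expf_neq0 ?oppr_eq0 ?invr_eq0 //;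
  by rewrite pnatr_eq0 -lt0n ?fact_gt0.
Qed.

Section Expansion.
Variables (p l K : nat) (n : nat -> nat).
Hypothesis p0 : (0 < p)%N.
Hypothesis n_inj : forall i j, (i < l)%N -> (j < l)%N -> n i = n j -> i = j.

Let C := core_bead p n.

Lemma sum_tuple_sub (k : {ffun 'I_l -> 'I_K}) :
  (forall j : 'I_l, p * k j <= n j)%N ->
  (\sum_(j < l) (n j - p * k j) + p * \sum_j k j = \sum_(j < l) n j)%N.
Proof.
by move=> h; rewrite big_distrr -big_split /=; apply: eq_bigr => j _; rewrite subnK.
Qed.

Lemma Rcoef_neq0 (k : {ffun 'I_l -> 'I_K}) : Rcoef p n k != 0 ->
  (forall j : 'I_l, p * k j <= n j)%N /\ vdm l (extend (fun j : 'I_l => n j - p * k j)%N) != 0.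
Proof.
rewrite mulf_eq0 negb_or => /andP[/prodf_neq0 h ->]; split=> // j.
by rewrite -alpha_neq0 // h.
Qed.

Lemma tuple_sub_mod (k : {ffun 'I_l -> 'I_K}) j : (forall j : 'I_l, p * k j <= n j)%N ->
  (j < l)%N -> (extend (fun j : 'I_l => n j - p * k j) j %% p = n j %% p)%N.
Proof.
move=> h jl; rewrite -[j]/(val (Ordinal jl)) extend_ord /=.
rewrite -{2}(subnK (h (Ordinal jl))) /= addnC mulnC modnMDl //.
Qed.

Lemma sum_extend (f : 'I_l -> nat) : (\sum_(j < l) extend f j = \sum_j f j)%N.
Proof. by apply: eq_bigr => j _; rewrite extend_ord. Qed.

Lemma sum_core_bead_n :
  (\sum_(j < l) C j + p * Rdeg p l n = \sum_(j < l) n j)%N.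
Proof.
rewrite /C sum_core_bead (sum_divn_modn p n) /Rdeg mulnBr.
have : (\sum_(j < l) occ (fun i => n i %% p) j <= \sum_(j < l) n j %/ p)%N.
  apply: (@sum_occ_le _ (fun i => n i %% p)%N (fun i => n i %/ p)%N).
  by apply: (div_inj (n := n) (m := n)).
rewrite -(leq_pmul2l p0); lia.
Qed.

(** The case of a single class in [sum_occ_le]; it keeps the exponent of ['X] in [Rpoly_wronskian]
    from being truncated. *)
Lemma sum_ord_le : (\sum_(j < l) j <= \sum_(j < l) C j)%N.
Proof.
have := @sum_occ_le _ (fun=> tt) C l.
rewrite (eq_bigr _ (fun (j : 'I_l) _ => occ_const j)); apply.
by move=> i j _ _ _; apply: core_bead_inj.
Qed.

(** In a nonzero term the nodes [n j - p * k j] are distinct and keep the residues of [n], so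
    [core_bead_min] bounds their sum from below. *)
Lemma Rcoef_deg (k : {ffun 'I_l -> 'I_K}) : Rcoef p n k != 0 -> (\sum_j k j <= Rdeg p l n)%N.
Proof.
move=> /Rcoef_neq0[h /vdm_neq0P inj].
have := core_bead_min p0 (fun j => @tuple_sub_mod k j h) inj.
rewrite sum_extend -(leq_add2r (p * \sum_j k j)) sum_tuple_sub // -sum_core_bead_n leq_add2l.
by rewrite leq_pmul2l.
Qed.

Lemma Rpoly_wronskian : (forall j, (j < l)%N -> (n j %/ p < K)%N) ->
  (vdm l n)^-1 *: \det (\matrix_(i < l, j < l) (Defs.qpoly p (n j))^`(i))
  = 'X^(\sum_(j < l) C j - \sum_(j < l) j) * (Rpoly p l K n \Po 'X^p).
Proof.
move=> nK; rewrite (wronskian_expand p0 nK) scaler_sumr linear_sum mulr_sumr.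
apply: eq_bigr => k _ /=; rewrite -/(Rcoef p n k) scalerA comp_polyZ -scalerAr.
have [->|cn] := eqVneq (Rcoef p n k) 0; first by rewrite mulr0 !scale0r.
congr (_ *: _); rewrite comp_Xn_poly -exprM -exprD; congr ('X^_).
have h1 := Rcoef_deg cn; have [h _] := Rcoef_neq0 cn.
have := sum_tuple_sub h; rewrite -sum_core_bead_n; have := sum_ord_le.
rewrite mulnBr; move: h1; rewrite -(leq_pmul2l p0).
move: (p * \sum_j k j)%N (p * Rdeg p l n)%N (\sum_(j < l) C j)%N (\sum_(j < l) j)%N.
by move: (\sum_(j < l) (n j - p * k j))%N => *; lia.
Qed.

(** Only the zero tuple reaches the top degree, and its coefficient is the Vandermonde product of
    [n] divided by itself. *)
Lemma Rpoly_lead : (0 < K)%N -> Rpoly p l K n \is monic /\ size (Rpoly p l K n) = (Rdeg p l n).+1.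
Proof.
move=> K0; pose k0 : {ffun 'I_l -> 'I_K} := [ffun=> Ordinal K0].
have vn : vdm l n != 0 by apply/vdm_neq0P.
have E : Rpoly p l K n = 'X^(Rdeg p l n) + \sum_(k | k != k0)
     ((vdm l n)^-1 * Rcoef p n k) *: 'X^(Rdeg p l n - \sum_j k j).
  rewrite /Rpoly (bigD1 k0) //=; congr (_ + _).
  rewrite big1 ?subn0 => [|j _]; last by rewrite ffunE.
  rewrite /Rcoef big1 => [|j _]; last first.
    rewrite ffunE /alpha /= muln0 subn0 fact0 mul1r expr0 mulr1 divff // pnatr_eq0.
    by rewrite -lt0n fact_gt0.
  rewrite mul1r (@vdm_eq _ _ n) ?mulVf ?scale1r // => j jl.
  by rewrite -[j in LHS]/(val (Ordinal jl)) extend_ord ffunE muln0 subn0.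
set S := \sum_(k | k != k0) _ in E.
have sS : (size S < size ('X^(Rdeg p l n) : {poly rat}))%N.
  rewrite size_polyXn ltnS; apply: (leq_trans (size_sum _ _ _)).
  apply/bigmax_leqP => k kn; have [->|cn] := eqVneq (Rcoef p n k) 0.
    by rewrite mulr0 scale0r size_poly0.
  apply: leq_trans (size_scale_leq _ _) _; rewrite size_polyXn.
  (* [Rcoef_deg] makes [Rdeg] positive here, so the truncated subtraction strictly decreases. *)
  have h1 := Rcoef_deg cn; suff k0' : (0 < \sum_j k j)%N by rewrite ltn_subrL k0' (leq_trans k0' h1).
  rewrite lt0n sum_nat_eq0; apply: contra kn => /forallP h.
  by apply/eqP/ffunP => j; apply/val_inj; rewrite ffunE; apply/eqP/(implyP (h j)).
by rewrite E monicE lead_coefDl // lead_coefXn size_polyDl // size_polyXn.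
Qed.

Let res i := (n i %% p)%N.

(** [n j %/ p - occ res i] is the only [k] with [n j - p k = C i]; the entry is [alpha] at this [k],
    and 0 when there is none. *)
Definition const_entry (i j : 'I_l) : rat :=
  if (res i == res j) && (occ res i <= n j %/ p)%N then
    ((n j)`!)%:R / (((n j %/ p - occ res i)`!)%:R * ((C i)`!)%:R) * (- (p%:R)^-1) ^+ (n j %/ p - occ res i)
  else 0.

Lemma const_entryE (i j : 'I_l) : (n j %/ p < K)%N ->
  \sum_(k < K) alpha p (n j) k * ((p * k <= n j) && (n j - p * k == C i))%N%:R = const_entry i j.
Proof.
move=> jK; rewrite /const_entry; case: ifP => [/andP[/eqP e le]|H].
  have kK : (n j %/ p - occ res i < K)%N by apply: leq_ltn_trans (leq_subr _ _) jK.
  have E : (n j = p * (n j %/ p - occ res i) + C i)%N.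
    rewrite /C /core_bead -/res mulnBr addnA subnK ?leq_mul2l ?le ?orbT //.
    by rewrite -[(n i %% p)%N]/(res i) e mulnC -divn_eq.
  rewrite (bigD1 (Ordinal kK)) //= big1 => [|k /eqP kn].
    have h : (p * (n j %/ p - occ res i) <= n j)%N by rewrite {2}E leq_addr.
    have E2 : (n j - p * (n j %/ p - occ res i))%N = C i by rewrite {1}E addKn.
    by rewrite /alpha h E2 eqxx mulr1 addr0.
  case: andP => [[h /eqP e2]|_]; last by rewrite mulr0.
  case: kn; apply/val_inj => /=; apply/eqP; rewrite -(eqn_pmul2l p0).
  by move: (subnK h); rewrite e2; move: E; lia.
rewrite big1 // => k _; case: andP => [[h /eqP e2]|_]; last by rewrite mulr0.
have e3 : (n j = k * p + C i)%N by rewrite -e2 mulnC subnKC.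
move: H; rewrite /res e3 modnMDl core_bead_mod // eqxx /=.
by rewrite divnMDl // core_bead_div // leq_addl.
Qed.

(** The left side is what the tuple [k] adds to the constant coefficient, up to normalization. By
    [core_bead_min_eq] it vanishes unless the nodes permute the core beads, and injectivity of [C]
    leaves a single matching permutation. The signed sum prepares the Leibniz formula. *)
Lemma Rcoef_const (k : {ffun 'I_l -> 'I_K}) :
  Rcoef p n k * (Rdeg p l n - \sum_j k j == 0)%N%:R =
  \sum_(s : 'S_l) (-1) ^+ s * vdm l C *
     \prod_(j < l) (alpha p (n j) (k j) * ((p * k j <= n j) && (n j - p * k j == C (s j)))%N%:R).
Proof.
have [/existsP[s /forallP hs]|] := boolP [exists s : 'S_l, [forall j : 'I_l, (p * k j <= n j)%N && (n j - p * k j == C (s j))%N]].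
  have h (j : 'I_l) : (p * k j <= n j)%N by case/andP: (hs j).
  have e (j : 'I_l) : (n j - p * k j)%N = C (s j) by case/andP: (hs j) => _ /eqP.
  rewrite (bigD1 s) //= [X in _ + X]big1 ?addr0 => [|t ts].
    have -> : (Rdeg p l n - \sum_j k j == 0)%N.
      have := sum_tuple_sub h; rewrite -sum_core_bead_n.
      have -> : (\sum_(j < l) (n j - p * k j) = \sum_(j < l) C j)%N.
        by rewrite [RHS](reindex_inj (@perm_inj _ s)); apply: eq_bigr => j _; rewrite e.
      move/addnI/eqP; rewrite eqn_pmul2l // => /eqP <-; by rewrite subnn.
    rewrite mulr1 /Rcoef mulrC; congr (_ * _).
      rewrite -vdm_perm; apply: vdm_eq => j jl.
      by rewrite -[j]/(val (Ordinal jl)) !extend_ord e.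
    by apply: eq_bigr => j _; rewrite hs mulr1.
  have [j tj] : exists j, s j != t j.
    apply/existsP; rewrite -negb_forall; apply: contra ts => /forallP E.
    by apply/eqP/permP => j; apply/eqP; rewrite eq_sym.
  rewrite (bigD1 j) //= h e; case: eqP => [E|_]; last by rewrite !(mulr0, mul0r).
  by case/eqP: tj; apply/ord_inj; apply: core_bead_inj E.
move=> H; rewrite [RHS]big1 => [|s _].
  have [->|cn] := eqVneq (Rcoef p n k) 0; first by rewrite mul0r.
  case: eqP => [W0|_]; last by rewrite mulr0.
  have [h /vdm_neq0P inj] := Rcoef_neq0 cn; have le := Rcoef_deg cn.
  case/negP: H; have W : Rdeg p l n = (\sum_j k j)%N.
    by apply/eqP; rewrite eqn_leq le andbT -subn_eq0 W0.
  have [|s hs] := core_bead_min_eq p0 (fun j => @tuple_sub_mod k j h) inj.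
    rewrite sum_extend; apply/eqP; rewrite -(eqn_add2r (p * \sum_j k j)) sum_tuple_sub //.
    by rewrite -sum_core_bead_n W.
  apply/existsP; exists s; apply/forallP => j; rewrite h /=.
  by have := hs j; rewrite extend_ord => ->.
move: H; rewrite negb_exists => /forallP/(_ s); rewrite negb_forall => /existsP[j hj].
by rewrite [\prod__ _](bigD1 j) //= (negbTE hj) !(mulr0, mul0r).
Qed.

(** For a fixed permutation the sum over tuples factors into one sum per column, which is
    [const_entry]. *)
Lemma Rpoly_const_det : (forall j, (j < l)%N -> (n j %/ p < K)%N) ->
  (Rpoly p l K n).[0] = (vdm l n)^-1 * vdm l C * \det (\matrix_(i < l, j < l) const_entry i j).
Proof.
move=> nK; rewrite /Rpoly horner_sum.
under eq_bigr => k _.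
  rewrite hornerZ hornerXn expr0n -mulrA Rcoef_const; over.
rewrite -mulr_sumr -mulrA; congr (_ * _).
rewrite exchange_big -det_tr /determinant mulr_sumr; apply: eq_bigr => s _ /=.
rewrite -mulr_sumr mulrCA -mulrA; congr (_ * (_ * _)).
rewrite -(bigA_distr_bigA (fun (j : 'I_l) (k : 'I_K) => alpha p (n j) k *
   ((p * k <= n j) && (n j - p * k == C (s j)))%N%:R)).
by apply: eq_bigr => j _; rewrite !mxE const_entryE // nK.
Qed.

(** Since [1/(q - a)!] is the falling factorial of [q] of length [a] over [q!], each entry is a
    column factor times a row factor times a falling factorial, and [det_newton] applies to what
    remains. *)
Lemma det_const_entry :
  \det (\matrix_(i < l, j < l) const_entry i j) =
  (\prod_(j < l) ((n j)`!%:R / (n j %/ p)`!%:R * (- (p%:R)^-1) ^+ (n j %/ p))) *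
  (\prod_(i < l) ((- p%:R) ^+ occ res i / (C i)`!%:R)) *
  \prod_(j < l) \prod_(i < j | res i == res j) ((n j %/ p)%:R - (n i %/ p)%:R).
Proof.
rewrite -(@det_newton _ _ res (fun i => (n i %/ p)%:R) ffact_poly).
- rewrite -[in LHS]det_tr -[X in _ = _ * X]det_tr /determinant mulr_sumr.
  apply: eq_bigr => s _; rewrite mulrCA; congr (_ * _).
  rewrite [X in _ * X * _](reindex_inj (@perm_inj _ s)) /= -!big_split /=.
  apply: eq_bigr => j _; rewrite !mxE /const_entry horner_ffact_poly.
  case: eqP => _ /=; last by rewrite !mulr0.
  case: leqP => h; last by rewrite ffact_small // !mulr0.
  have f0 m : (m`!)%:R != 0 :> rat by rewrite pnatr_eq0 -lt0n fact_gt0.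
  have pn : - p%:R != 0 :> rat by rewrite oppr_eq0 pnatr_eq0 -lt0n.
  have g0 : ((n j %/ p) ^_ occ res (s j))%:R != 0 :> rat by rewrite pnatr_eq0 -lt0n ffact_gt0.
  rewrite -invrN.
  have -> : (- p%:R)^-1 ^+ (n j %/ p) =
     (- p%:R)^-1 ^+ (n j %/ p - occ res (s j)) * (- p%:R)^-1 ^+ occ res (s j) :> rat.
    by rewrite -exprD subnK.
  rewrite -[in RHS](ffact_fact h) natrM !exprVn.
  have := f0 (n j %/ p - occ res (s j))%N; have := f0 (C (s j)).
  have := expf_neq0 (n j %/ p - occ res (s j)) pn; have := expf_neq0 (occ res (s j)) pn.
  move=> h1 h2 h3 h4; field; rewrite h3 h4 g0; apply/and5P; split => //.
- by move=> k; apply: ffact_poly_monic.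
- exact: size_ffact_poly.
move=> i j il jl e /eqP; rewrite eqr_nat => /eqP e2; apply: n_inj => //.
by rewrite (divn_eq (n i) p) (divn_eq (n j) p) e2; congr (_ + _)%N.
Qed.

Lemma vdm_split :
  vdm l n = (\prod_(j < l) \prod_(i < j | res i == res j) ((n j)%:R - (n i)%:R)) *
            (\prod_(j < l) \prod_(i < j | res i != res j) ((n j)%:R - (n i)%:R)).
Proof. by rewrite -big_split; apply: eq_bigr => j _; rewrite (bigID (fun i : 'I_j => res i == res j)). Qed.

(** On one runner [n j - n i] is [p] times the difference of levels, and [j] has [occ res j] such
    partners [i < j]. *)
Lemma prod_same :
  (\prod_(j < l) (- p%:R) ^+ occ res j) *
    \prod_(j < l) \prod_(i < j | res i == res j) ((n j %/ p)%:R - (n i %/ p)%:R) =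
  (-1) ^+ (\sum_(j < l) occ res j)%N *
    \prod_(j < l) \prod_(i < j | res i == res j) ((n j)%:R - (n i)%:R) :> rat.
Proof.
rewrite -prodrXr -!big_split; apply: eq_bigr => j _ /=.
rewrite exprNn -mulrA; congr (_ * _).
have -> : p%:R ^+ occ res j = \prod_(i < j | res i == res j) p%:R :> rat.
  rewrite -(big_mkord (fun i => res i == res j) (fun=> p%:R)) big_const_seq /index_iota subn0.
  by rewrite -/(occ res j); elim: (occ res j) => //= m <-; rewrite exprS.
rewrite -big_split; apply: eq_bigr => i /eqP e /=.
rewrite (divn_eq (n j) p) (divn_eq (n i) p) -/(res i) -/(res j) e !natrD !natrM.
rewrite !divnMDl // !(divn_small (ltn_pmod _ p0)) !addn0; ring.
Qed.

Lemma prod_fact :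
  \prod_(j < l) ((n j)`!%:R / (n j %/ p)`!%:R * (- (p%:R)^-1) ^+ (n j %/ p)) =
  (-1) ^+ (\sum_(j < l) n j %/ p)%N * \prod_(j < l) (nonp_fact p (n j))%:R :> rat.
Proof.
rewrite -prodrXr -big_split; apply: eq_bigr => j _ /=.
rewrite {1}(fact_nonp (n j) p0) !natrM natrX [(- _^-1) ^+ _]exprNn exprVn.
have f0 m : (m`!)%:R != 0 :> rat by rewrite pnatr_eq0 -lt0n fact_gt0.
have := f0 (n j %/ p)%N.
have : p%:R ^+ (n j %/ p) != 0 :> rat by rewrite expf_neq0 // pnatr_eq0 -lt0n.
by move=> h1 h2; field; rewrite h1 h2.
Qed.

(** The same-runner part of the Vandermonde product of [n] cancels against the Newton determinant,
    and the powers of [p] against the factorials; only pairs on different runners remain. *)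
Lemma Rpoly_const : (forall j, (j < l)%N -> (n j %/ p < K)%N) ->
  (Rpoly p l K n).[0] = (-1) ^+ Rdeg p l n * (vdm l C / \prod_(j < l) (C j)`!%:R) *
    (\prod_(j < l) (nonp_fact p (n j))%:R /
     \prod_(j < l) \prod_(i < j | res i != res j) ((n j)%:R - (n i)%:R)).
Proof.
move=> nK; rewrite Rpoly_const_det // det_const_entry prod_fact big_split /= prodfV.
have vn : vdm l n != 0 by apply/vdm_neq0P.
have Cf : \prod_(j < l) (C j)`!%:R != 0 :> rat.
  by apply/prodf_neq0 => j _; rewrite pnatr_eq0 -lt0n fact_gt0.
have -> : (-1) ^+ Rdeg p l n = (-1) ^+ (\sum_(j < l) n j %/ p)%N * (-1) ^+ (\sum_(j < l) occ res j)%N :> rat.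
  have le : (\sum_(j < l) occ res j <= \sum_(j < l) n j %/ p)%N.
    apply: (@sum_occ_le _ res (fun i => n i %/ p)%N).
    by apply: (div_inj (n := n) (m := n)).
  rewrite /Rdeg -/res -[in RHS](subnK le) exprD -mulrA -expr2.
  by rewrite sqrr_sign mulr1.
have := prod_same; move: vn; rewrite vdm_split mulf_eq0 negb_or => /andP[].
move: (\prod_(j < l) \prod_(i < j | _ == _) ((n j)%:R - _)) => s1.
move: (\prod_(j < l) \prod_(i < j | _ != _) _) => s2.
move: (\prod_(j < l) (- p%:R) ^+ occ res j) => s3.
move: (\prod_(j < l) \prod_(i < j | _ == _) _) => s4.
move: Cf; move: (\prod_(j < l) (C j)`!%:R) (\prod_(j < l) (nonp_fact p (n j))%:R) => cf N Cf.
move: (_ ^+ _) (_ ^+ _) => sq so s1n s2n e.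
have -> : (s1 * s2)^-1 * vdm l C * (sq * N * (s3 / cf) * s4)
  = (s1 * s2)^-1 * vdm l C * sq * N / cf * (s3 * s4) by ring.
by rewrite e; field; rewrite Cf s1n s2n.
Qed.

End Expansion.

(** * Hook lengths and beads *)

Notation weakly_decr := (sorted (fun a b : nat => b <= a)%N).

Lemma geq_trans : transitive (fun a b : nat => b <= a)%N.
Proof. by move=> y x z h1 h2; apply: leq_trans h1. Qed.

Lemma weakly_decrP s :
  reflect (forall i, nth 0 s i.+1 <= nth 0 s i)%N (weakly_decr s).
Proof.
apply: (iffP (sortedP 0%N)) => h i; last by [].
have [|le] := ltnP i.+1 (size s); first exact: h.
by rewrite (nth_default _ le).
Qed.

Lemma weakly_decr_nth s i j : weakly_decr s -> (i <= j)%N -> (nth 0 s j <= nth 0 s i)%N.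
Proof.
move=> /weakly_decrP h; elim: j => [|j IH]; first by rewrite leqn0 => /eqP ->.
rewrite leq_eqVlt => /predU1P[->//|ij]; apply: leq_trans (h j) _; exact: IH.
Qed.

Lemma lt_conj_part s c i : weakly_decr s -> (i < conj_part s c)%N = (c < nth 0 s i)%N.
Proof.
rewrite /conj_part; elim: s i => [|a s IH] i; first by rewrite nth_nil.
move=> /= hs; have ss := path_sorted hs.
case: (ltnP c a) => ca; first by case: i => [|i] //=; rewrite add1n ltnS IH.
have h : forall k, (nth 0 s k <= c)%N.
  move=> k; apply: leq_trans ca; case: (ltnP k (size s)) => ks; last by rewrite nth_default.
  by apply: (allP (order_path_min geq_trans hs)); apply: mem_nth.
have -> : count (fun x => c < x)%N s = 0%N.
  apply/eqP; rewrite -leqn0 leqNgt -has_count; apply/hasPn => x /(nthP 0%N)[k _ <-].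
  by rewrite -leqNgt h.
by case: i => [|i] /=; rewrite ltn0 ltnNge ?ca ?h.
Qed.

(** The degree vector of [s] padded with zero parts to [l] rows. A fixed [l] gives all partitions of
    a strip chain the same number of beads. *)
Definition bead (l : nat) (s : seq nat) (i : nat) : nat := nth 0%N s i + (l - i.+1).

Lemma bead_lt l s i j : weakly_decr s -> (i < j)%N -> (j < l)%N -> (bead l s j < bead l s i)%N.
Proof.
by move=> hs ij jl; rewrite /bead; have := weakly_decr_nth hs (ltnW ij); lia.
Qed.

Lemma bead_inj l s i j : weakly_decr s -> (i < l)%N -> (j < l)%N -> bead l s i = bead l s j -> i = j.
Proof.
move=> hs il jl e; case: (ltngtP i j) => // h.
  by have := bead_lt hs h jl; rewrite e ltnn.
by have := bead_lt hs h il; rewrite e ltnn.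
Qed.

(** Both sides have [bead l s i] entries, so it is enough that those on the left are distinct and
    lie in the range. *)
Lemma hook_row l s i : weakly_decr s -> (size s <= l)%N -> (i < l)%N ->
  perm_eq ([seq hook s i c | c <- iota 0 (nth 0%N s i)]
           ++ [seq bead l s i - bead l s j | j <- iota i.+1 (l - i.+1)]%N)
          (iota 1 (bead l s i)).
Proof.
move=> hs sl il; set L := _ ++ _.
have hc c : (conj_part s c <= l)%N by apply: leq_trans (count_size _ _) sl.
have hi c : (c < nth 0%N s i)%N -> (i < conj_part s c)%N by rewrite lt_conj_part.
have cm c d : (c <= d)%N -> (conj_part s d <= conj_part s c)%N.
  by move=> cd; apply: sub_count => x /=; lia.
have uL : uniq L.
  rewrite cat_uniq; apply/and3P; split.
  - rewrite map_inj_in_uniq ?iota_uniq // => c d.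
    rewrite !mem_iota /= !add0n => h1 h2; have := hi _ h1; have := hi _ h2.
    rewrite /hook; case: (ltngtP c d) => // cd; have := cm _ _ (ltnW cd); lia.
  - apply/hasPn => x /mapP[j]; rewrite mem_iota => /andP[ij jl] ->.
    apply/negP => /mapP[c]; rewrite mem_iota add0n /= => h.
    have h1 := hi _ h; have jl' : (j < l)%N by lia.
    have h2 := weakly_decr_nth hs (ltnW ij).
    (* If column [c] meets row [j], the hook length exceeds the bead difference; otherwise it is
       smaller. *)
    have [h3|h3] := ltnP c (nth 0%N s j).
      have : (j < conj_part s c)%N by rewrite lt_conj_part.
      by rewrite /hook /bead; lia.
    have : (conj_part s c <= j)%N by rewrite leqNgt lt_conj_part // -leqNgt.
    by rewrite /hook /bead; lia.
  - rewrite map_inj_in_uniq ?iota_uniq // => j k; rewrite !mem_iota => /andP[ij jl] /andP[ik kl].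
    have jl' : (j < l)%N by lia.
    have kl' : (k < l)%N by lia.
    have := bead_lt hs ij jl'; have := bead_lt hs ik kl' => h1 h2 h3.
    by apply: (bead_inj hs jl' kl'); lia.
have sub : {subset L <= iota 1 (bead l s i)}.
  move=> x; rewrite mem_cat => /orP[] /mapP[c]; rewrite !mem_iota => h ->.
    have := hi c; have := hc c; rewrite /hook /bead; lia.
  have cl : (c < l)%N by lia.
  have ic : (i < c)%N by lia.
  by have := bead_lt hs ic cl; lia.
have [|_ e] := uniq_min_size uL sub.
  by rewrite size_cat !size_map !size_iota.
by apply: uniq_perm; rewrite ?iota_uniq.
Qed.

Lemma big_cells (s : seq nat) l (P : pred nat) : (size s <= l)%N ->
  (\prod_(c <- cells s | P (hook s c.1 c.2)) hook s c.1 c.2 =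
   \prod_(i < l) \prod_(h <- [seq hook s i c | c <- iota 0 (nth 0 s i)] | P h) h)%N.
Proof.
move=> sl; rewrite big_flatten big_map /=.
transitivity (\prod_(i <- iota 0 (size s)) \prod_(h <- [seq hook s i c | c <- iota 0 (nth 0 s i)] | P h) h)%N.
  by apply: eq_bigr => i _; rewrite nth_nil subn0 !big_map.
rewrite -(subnK sl) addnC -{1}(subn0 (size s)) big_mkord big_split_ord /=.
rewrite [X in (_ * X)%N]big1 ?muln1 // => i _.
by rewrite nth_default ?leq_addr //= big_nil.
Qed.

(** The product of [hook_row] over all rows. The predicate [P] serves both the full hook product and
    that of the hooks prime to the divisibility by [p]. *)
Lemma hook_prod_beads (s : seq nat) l (P : pred nat) : weakly_decr s -> (size s <= l)%N ->
  (\prod_(c <- cells s | P (hook s c.1 c.2)) hook s c.1 c.2 *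
   \prod_(j < l) \prod_(i < j | P (bead l s i - bead l s j)) (bead l s i - bead l s j)
  = \prod_(i < l) \prod_(1 <= h < (bead l s i).+1 | P h) h)%N.
Proof.
move=> hs sl; rewrite (big_cells P sl).
have -> : (\prod_(j < l) \prod_(i < j | P (bead l s i - bead l s j)) (bead l s i - bead l s j)
  = \prod_(i < l) \prod_(h <- [seq bead l s i - bead l s j | j <- iota i.+1 (l - i.+1)] | P h) h)%N.
  under eq_bigr => j _ do rewrite (big_ord_widen_cond l (fun i => P (bead l s i - bead l s j)%N)
     (fun i => (bead l s i - bead l s j)%N)) ?(ltnW (ltn_ord j)) //.
  rewrite (exchange_big_dep predT) //=; apply: eq_bigr => i _.
  rewrite big_map -/(index_iota i.+1 l) big_geq_mkord.
  by apply: eq_bigl => j; rewrite andbC.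
rewrite -big_split; apply: eq_bigr => i _ /=; rewrite -big_cat /index_iota subn1 /=.
by apply: perm_big; apply: hook_row.
Qed.

(** * The size of the p-quotient *)

Lemma rng_cat B : rng B = [seq k%:Z - B%:Z | k <- iota 0 B] ++ [seq k%:Z | k <- iota 0 B].
Proof.
rewrite /rng mul2n -addnn iotaD map_cat; congr (_ ++ _).
have -> : iota (0 + B) B = [seq (B + k)%N | k <- iota 0 B] by rewrite -iotaDl addn0.
rewrite -map_comp; apply: eq_map => k /=; lia.
Qed.

(** All negative positions are filled, so a bead [k] contributes the gaps among [0, ..., k - 1], and
    negative beads contribute nothing. *)
Lemma sumn_maya_part (N : int -> bool) B : (forall m : int, m < 0 -> N m) ->
  sumn (maya_part N B) =
  (\sum_(k <- iota 0 B | N k%:Z) (k - count (fun k' : nat => N k'%:Z) (iota 0 k)))%N.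
Proof.
move=> Nneg; have neg (k : nat) : k \in iota 0 B -> k%:Z - B%:Z < 0 by rewrite mem_iota; lia.
rewrite /maya_part (perm_sumn (permEl (perm_sort _ _))) sumnE big_filter.
rewrite big_mkcond big_map big_filter.
under eq_bigr => m _ do have -> : forall a : nat, (if (0 < a)%N then a else 0%N) = a by case.
rewrite {1}rng_cat big_cat /= !big_map big_seq_cond big1 ?add0n => [|k /andP[kB _]]; last first.
  apply/eqP; rewrite -leqn0 leqNgt -has_count -all_predC; apply/allP => n _ /=.
  by apply/negP => /andP[/negP h h2]; apply: h; apply: Nneg; have := neg _ kB; lia.
rewrite big_seq_cond [RHS]big_seq_cond; apply: eq_bigr => k /andP[]; rewrite mem_iota add0n => /= kB _.
rewrite rng_cat count_cat !count_map; set c0 := count _ _.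
have -> : c0 = 0%N.
  rewrite /c0; apply/eqP; rewrite -leqn0 leqNgt -has_count -all_predC; apply/allP => n nB /=.
  by rewrite Nneg // neg.
rewrite add0n -(subnKC (ltnW kB)) iotaD count_cat [X in (_ + X)%N](_ : _ = 0)%N; last first.
  apply/eqP; rewrite -leqn0 leqNgt -has_count -all_predC; apply/allP => n /=.
  by rewrite mem_iota => h; apply/negP => /andP[_]; lia.
rewrite addn0 -[X in _ = (X - _)%N](size_iota 0) -(count_predC (fun k' : nat => N k'%:Z)) addKn.
apply: eq_in_count => n /=; rewrite mem_iota => h.
by rewrite andbC; have -> : n%:Z < k%:Z by lia.
Qed.

(** Division with remainder splits the positions below [p * B] into [p] runners of [B] levels. *)
Lemma sum_runners (D : seq nat) p B (F : nat -> nat) : (0 < p)%N -> uniq D ->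
  (forall d, d \in D -> d < p * B)%N ->
  (\sum_(i <- iota 0 p) \sum_(k <- iota 0 B | (p * k + i)%N \in D) F (p * k + i)
   = \sum_(d <- D) F d)%N.
Proof.
move=> p0 uD hD.
have dm i k : (i \in iota 0 p -> ((p * k + i) %/ p = k) /\ ((p * k + i) %% p = i))%N.
  rewrite mem_iota add0n mulnC => /= ip.
  by rewrite divnMDl // divn_small // addn0 modnMDl modn_small.
pose A := [seq (p * k + i)%N | i <- iota 0 p, k <- iota 0 B].
have uA : uniq A.
  apply: allpairs_uniq; rewrite ?iota_uniq // => -[i k] [i' k'] /allpairsP[[a b] /= [h _ [-> _]]].
  move=> /allpairsP[[a' b'] /= [h' _ [-> _]]] /= e.
  have [e1 e2] := dm _ k h; have [e3 e4] := dm _ k' h'.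
  by congr pair; [rewrite -e2 -e4 e | rewrite -e1 -e3 e].
have pD : perm_eq D [seq d <- A | d \in D].
  apply: uniq_perm; rewrite ?filter_uniq // => d; rewrite mem_filter.
  case: (boolP (d \in D)) => //= dD; symmetry; apply/allpairsP; exists (d %% p, d %/ p)%N => /=.
  rewrite !mem_iota !add0n /= ltn_mod p0 ltn_divLR // mulnC hD //; split => //.
  by rewrite mulnC -divn_eq.
rewrite (perm_big _ pD) /= big_filter [RHS]big_mkcond /A big_allpairs_dep.
by apply: eq_bigr => i _; rewrite -big_mkcond.
Qed.

Lemma sum_nth_le (s : seq nat) i : (nth 0 s i <= sumn s)%N.
Proof.
elim: s i => [|a s IH] [|i] //=; first exact: leq_addr.
by apply: leq_trans (IH i) _; rewrite leq_addl.
Qed.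

(** A bead of level [b] and rank [r] on its runner has [b - r] gaps below it there; [sum_rank] then
    replaces ranks by [occ]. *)
Lemma quot_size_beads p (s : seq nat) : (0 < p)%N -> weakly_decr s ->
  quot_size p s = Rdeg p (size s) (bead (size s) s).
Proof.
move=> p0 hs; set l := size s; set n := bead l s.
pose cl i := (n i %% p)%N; pose b i := (n i %/ p)%N.
have n_inj i j : (i < l)%N -> (j < l)%N -> n i = n j -> i = j by apply: bead_inj.
have binj : forall i j, (i < l)%N -> (j < l)%N -> cl i = cl j -> b i = b j -> i = j.
  by apply: (div_inj (n := n) (m := n)).
have uD : uniq (degvec s).
  by rewrite map_inj_in_uniq ?iota_uniq // => i j; rewrite !mem_iota => h1 h2; apply: n_inj.
have mem_D d : d \in degvec s -> exists2 j, (j < l)%N & d = n j.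
  by move=> /mapP[j]; rewrite mem_iota => jl ->; exists j.
have D_mem j : (j < l)%N -> n j \in degvec s by move=> jl; apply: map_f; rewrite mem_iota.
pose B := (sumn s + size s).+1.
pose F d := (d %/ p - count (fun k => (p * k + d %% p)%N \in degvec s) (iota 0 (d %/ p)))%N.
have maya i (k : nat) : maya_lam s (p%:Z * k%:Z + i%:Z) = ((p * k + i)%N \in degvec s).
  rewrite /maya_lam -PoszM -PoszD mem_map //; by move=> ? ? [].
rewrite /quot_size sumnE !big_map.
transitivity (\sum_(i <- iota 0 p) \sum_(k <- iota 0 B | (p * k + i)%N \in degvec s) F (p * k + i))%N.
  rewrite big_seq [RHS]big_seq; apply: eq_bigr => i; rewrite mem_iota add0n => /= ip.
  rewrite sumn_maya_part => [|m m0]; last by rewrite /maya_lam; apply/orP; left; nia.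
  apply: eq_big => [k|k _]; first by rewrite maya.
  rewrite /F mulnC divnMDl // modnMDl divn_small // addn0 modn_small //.
  by congr (_ - _)%N; apply: eq_count => k'; rewrite maya.
(* The window is wide enough, since every bead is below [B]. *)
rewrite sum_runners // => [|d /mem_D[j jl ->]]; last first.
  by have := sum_nth_le s j; rewrite /n /bead /B -/l; nia.
rewrite big_map -{1}(subn0 (size s)) big_mkord -/l /Rdeg.
transitivity (\sum_(j < l) (b j - rank cl b l j))%N.
  apply: eq_bigr => j _; rewrite -/(n j) /F -/(b j); congr (_ - _)%N.
  rewrite /rank -!size_filter -[RHS](size_map b); apply: perm_size; apply: uniq_perm.
  - by rewrite filter_uniq ?iota_uniq.
  - rewrite map_inj_in_uniq ?filter_uniq ?iota_uniq // => u v.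
    rewrite !mem_filter !mem_iota !add0n => /andP[/andP[/eqP e1 _] /= l1] /andP[/andP[/eqP e2 _] /= l2].
    by apply: binj; rewrite ?e1 ?e2.
  move=> k; rewrite mem_filter mem_iota add0n; apply/andP/mapP => [[/mem_D[i il e] /= kb]|[i]].
    have eb : b i = k by rewrite /b -e mulnC divnMDl // divn_small ?addn0 // ltn_mod.
    have ec : cl i = cl j by rewrite /cl -e mulnC modnMDl modn_mod.
    by exists i; rewrite ?eb // mem_filter mem_iota il ec eqxx eb kb.
  rewrite mem_filter mem_iota => /andP[/andP[/eqP e bb] /= il] ->; split => //.
  have -> : (p * b i + n j %% p = n i)%N by rewrite -[(n j %% p)%N]/(cl j) -e mulnC -divn_eq.
  exact: D_mem.
rewrite sumnB => [|j _]; last exact: rank_le.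
by rewrite sum_rank.
Qed.

(** * Border strips and beads *)

Definition beads (l : nat) (s : seq nat) : seq nat := [seq bead l s i | i <- iota 0 l].

Lemma partition_decr s : is_partition s -> weakly_decr s.
Proof. by case/andP. Qed.

Lemma mem_skew_cells lam nu i c :
  ((i, c) \in skew_cells lam nu) = (nth 0 nu i <= c < nth 0 lam i)%N.
Proof.
apply/flattenP/idP => [[r /mapP[k]]|/andP[h1 h2]].
  by rewrite mem_iota => kl -> /mapP[j]; rewrite mem_iota => h [-> ->]; lia.
exists [seq (i, j) | j <- iota (nth 0%N nu i) (nth 0%N lam i - nth 0%N nu i)].
  apply/mapP; exists i => //; rewrite mem_iota add0n /=.
  by rewrite ltnNge; apply/negP => h; rewrite nth_default in h2.
by apply/mapP; exists c => //; rewrite mem_iota; lia.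
Qed.

Lemma size_skew_cells lam nu :
  size (skew_cells lam nu) = (\sum_(i < size lam) (nth 0 lam i - nth 0 nu i))%N.
Proof.
rewrite /skew_cells size_flatten /shape sumnE !big_map -{1}(subn0 (size lam)) big_mkord.
by apply: eq_bigr => i _; rewrite size_map size_iota.
Qed.

Lemma sumn_nth s l : (size s <= l)%N -> sumn s = (\sum_(i < l) nth 0 s i)%N.
Proof.
move=> sl; rewrite -(subnKC sl) big_split_ord /= [X in (_ + X)%N]big1 ?addn0 => [|i _].
  by rewrite sumnE (big_nth 0%N) big_mkord.
by rewrite nth_default // leq_addr.
Qed.

Lemma sumn_beads s l : (size s <= l)%N -> (sumn (beads l s) = sumn s + \sum_(i < l) (l - i.+1))%N.
Proof.
move=> sl; rewrite (sumn_nth sl) -big_split /beads sumnE big_map -{1}(subn0 l) big_mkord.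
by [].
Qed.

Lemma subdiagram_nth nu lam i : subdiagram nu lam -> (nth 0 nu i <= nth 0 lam i)%N.
Proof.
move=> /andP[_ /allP h]; case: (ltnP i (size nu)) => hi; last by rewrite (nth_default _ hi).
by apply: h; rewrite mem_iota.
Qed.

Lemma sumn_skew lam nu : subdiagram nu lam -> (sumn lam = sumn nu + size (skew_cells lam nu))%N.
Proof.
move=> sd; have /andP[sz _] := sd.
rewrite size_skew_cells (sumn_nth sz) (sumn_nth (leqnn _)) -big_split.
by apply: eq_bigr => i _ /=; rewrite subnKC // subdiagram_nth.
Qed.

(** A strip in rows [a] to [b] takes bead [a] out, moves the next [b - a] beads up by one index, and
    puts the new bead after them. *)
Lemma beads_split l lam nu a b : (a <= b)%N -> (b < l)%N ->
  (forall i, (i < a)%N -> bead l nu i = bead l lam i) ->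
  (forall i, (a <= i < b)%N -> bead l nu i = bead l lam i.+1) ->
  (forall i, (b < i < l)%N -> bead l nu i = bead l lam i) ->
  exists s1 s2 s3, [/\ beads l lam = s1 ++ bead l lam a :: s2 ++ s3,
     beads l nu = s1 ++ s2 ++ bead l nu b :: s3 & size s2 = (b - a)%N].
Proof.
move=> ab bl h1 h2 h3.
exists [seq bead l lam i | i <- iota 0 a], [seq bead l lam i | i <- iota a.+1 (b - a)],
  [seq bead l lam i | i <- iota b.+1 (l - b.+1)]; split; last by rewrite size_map size_iota.
  have e : iota 0 l = iota 0 a ++ a :: iota a.+1 (b - a) ++ iota b.+1 (l - b.+1).
    have {1}-> : l = (a + (1 + ((b - a) + (l - b.+1))))%N by lia.
    by rewrite iotaD add0n iotaD /= addn1 iotaD; congr (_ ++ _ :: _ ++ iota _ _); lia.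
  by rewrite /beads e map_cat /= map_cat.
have e : iota 0 l = iota 0 a ++ iota a (b - a) ++ b :: iota b.+1 (l - b.+1).
  have {1}-> : l = (a + ((b - a) + (1 + (l - b.+1))))%N by lia.
  by rewrite iotaD add0n iotaD subnKC // iotaD /= addn1.
rewrite /beads e !map_cat /=; congr (_ ++ _ ++ _ :: _).
- by apply/eq_in_map => i; rewrite mem_iota => hi; apply: h1; lia.
- rewrite -[in RHS]addn1 addnC iotaDl -map_comp; apply/eq_in_map => i; rewrite mem_iota => hi /=.
  by rewrite h2 ?add1n //; lia.
by apply/eq_in_map => i; rewrite mem_iota => hi; apply: h3; lia.
Qed.

(** Some step of the path goes from row [i] to row [i + 1], and such a step stays in its column. *)
Lemma path_crosses_rows (c : seq (nat * nat)) i x s : path cell_adj x s ->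
  x \in c -> all (fun z => z \in c) s -> (x.1 <= i)%N -> (i < (last x s).1)%N ->
  exists k, ((i, k) \in c) && ((i.+1, k) \in c).
Proof.
elim: s x => [|y s IH] x /=; first by move=> _ _ _ h1 h2; lia.
move=> /andP[adj ps] xc /andP[yc sc] xi li.
have [yi|iy] := leqP y.1 i; first exact: IH ps yc sc yi li.
exists x.2; case: x y adj xc yc xi iy {ps li} => [x1 x2] [y1 y2]; rewrite /cell_adj /=.
move=> adj xc yc xi iy.
have [e1 [e2 e3]] : i = x1 /\ x1.+1 = y1 /\ x2 = y2.
  by move: adj => /orP[/andP[/eqP ? _]|/andP[/eqP ? /orP[]/eqP ?]]; lia.
by rewrite e1 xc e2 e3 yc.
Qed.

(** The strip occupies consecutive rows whose lengths satisfy the relation [row], which is the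
    hypothesis of [beads_split]; comparing sums then locates the new bead. *)
Lemma border_strip_beads p l lam nu : (0 < p)%N -> border_strip p lam nu -> (size lam <= l)%N ->
  exists s1 s2 s3 x, [/\ (p <= x)%N, beads l lam = s1 ++ x :: s2 ++ s3,
     beads l nu = s1 ++ s2 ++ (x - p)%N :: s3 & size s2 = strip_height lam nu].
Proof.
move=> p0 [lamP nuP sd sz [conn n22]] sl.
pose L := nth 0%N lam; pose N := nth 0%N nu.
have NL i : (N i <= L i)%N by apply: subdiagram_nth.
have Ls i : (0 < L i)%N -> (i < size lam)%N.
  by rewrite ltnNge /L; case: (ltnP i (size lam)) => // h; rewrite nth_default.
have ex : exists i, (N i < L i)%N.
  have [/existsP[i hi]|/existsPn h] := boolP [exists i : 'I_(size lam), (N i < L i)%N].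
    by exists i.
  move: p0; rewrite -sz size_skew_cells big1 // => i _; have := h i; rewrite /N /L; lia.
have bound i : (N i < L i)%N -> (i <= size lam)%N by move=> h; apply/ltnW/Ls; lia.
case: (ex_minnP ex) => a ha amin; case: (ex_maxnP ex bound) => b hb bmax.
have ab : (a <= b)%N by apply: amin.
have bl : (b < l)%N by apply: leq_trans (Ls b _) sl; lia.
(* Consecutive rows of the strip share exactly one column: connectedness gives at least one, and two
   would create a 2x2 square at column [N i]. *)
have row i : (a <= i < b)%N -> (L i.+1 = (N i).+1)%N.
  move=> /andP[ai ib].
  have inA : (a, N a) \in skew_cells lam nu by rewrite mem_skew_cells -/(N a) -/(L a) leqnn.
  have inB : (b, N b) \in skew_cells lam nu by rewrite mem_skew_cells -/(N b) -/(L b) leqnn.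
  have [s [ps ls as_]] := conn _ _ inA inB.
  have [|k] := path_crosses_rows ps inA as_ ai; first by rewrite ls.
  rewrite !mem_skew_cells -!/(N _) -!/(L _) => /andP[/andP[h1 h2] /andP[h3 h4]].
  have := n22 i (N i); rewrite !mem_skew_cells -!/(N _) -!/(L _).
  have := weakly_decr_nth (partition_decr lamP) (leqnSn i); rewrite -!/(L _).
  have := weakly_decr_nth (partition_decr nuP) (leqnSn i); rewrite -!/(N _).
  by move=> h5 h6; lia.
have rows i : (i \in map fst (skew_cells lam nu)) = (a <= i <= b)%N.
  apply/mapP/andP => [[[i' c] h ->]|[ai ib]] /=.
    move: h; rewrite mem_skew_cells -/(N _) -/(L _) => h.
    by split; [apply: amin|apply: bmax]; lia.
  exists (i, N i) => //; rewrite mem_skew_cells -/(N _) -/(L _) leqnn /=.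
  move: ib; rewrite leq_eqVlt => /predU1P[->//|ib].
  have := row i; rewrite ai ib => /(_ isT) <-.
  exact: (weakly_decr_nth (partition_decr lamP) (leqnSn i)).
have ht : strip_height lam nu = (b - a)%N.
  rewrite /strip_height (perm_size (s2 := iota a (b - a).+1)) ?size_iota //.
  apply: uniq_perm; rewrite ?undup_uniq ?iota_uniq // => i.
  by rewrite mem_undup rows mem_iota; lia.
have [|i hi|i hi|s1 [s2 [s3 [e1 e2 e3]]]] := @beads_split l lam nu a b ab bl.
- move=> i ia; rewrite /bead -/(N _) -/(L _); congr (_ + _)%N.
  by case: (ltngtP (N i) (L i)) (NL i) => // h _; have := amin i h; lia.
- have := row i hi; rewrite /bead -/(N _) -/(L _); lia.
- rewrite /bead -/(N _) -/(L _); congr (_ + _)%N.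
  by case: (ltngtP (N i) (L i)) (NL i) => // h _; have := bmax i h; lia.
have /andP[sz2 _] := sd.
(* The bead sums differ by the [p] removed cells and only one bead changes value, so it drops by
   [p]. *)
have := sumn_beads (leq_trans sz2 sl); have := sumn_beads sl; rewrite (sumn_skew sd) sz.
rewrite e1 e2 !sumn_cat /= !sumn_cat /= => f1 f2.
exists s1, s2, s3, (bead l lam a); split; rewrite ?ht //; first by lia.
by congr (_ ++ _ ++ _ :: _); lia.
Qed.

(** * Constructing a border strip from a vacant bead position *)

Definition reach (c : seq (nat * nat)) (x y : nat * nat) : Prop :=
  exists s, [/\ path cell_adj x s, last x s = y & all (fun z => z \in c) s].

Lemma cell_adj_sym : symmetric cell_adj.
Proof.
by move=> x y; rewrite /cell_adj [x.1 == _]eq_sym [x.2 == y.2]eq_sym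
  [(x.2 == _) || _]orbC [(x.1 == _) || _]orbC.
Qed.

Lemma reach_trans c x y z : reach c x y -> reach c y z -> reach c x z.
Proof.
move=> [s [ps ls sc]] [t [pt lt tc]]; exists (s ++ t).
by rewrite cat_path ps ls pt last_cat ls lt all_cat sc tc.
Qed.

Lemma reach_sym c x y : x \in c -> reach c x y -> reach c y x.
Proof.
move=> xc [s [ps <- sc]]; exists (rev (belast x s)).
rewrite rev_path (eq_path (e' := cell_adj)); last by move=> u v; rewrite cell_adj_sym.
split=> //; first by case: s {ps sc} => //= a s; rewrite rev_cons last_rcons.
rewrite all_rev; apply/allP => z /mem_belast; rewrite inE => /predU1P[->//|].
exact: (allP sc).
Qed.

Lemma filter_pos_nth s i : weakly_decr s -> nth 0%N [seq x <- s | (0 < x)%N] i = nth 0%N s i.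
Proof.
elim: s i => [|a s IH] i //= hs; have ss := path_sorted hs.
case: ltnP => a0; first by case: i => [|i] //=; apply: IH.
have s0 k : nth 0%N s k = 0%N.
  by have := @weakly_decr_nth (a :: s) 0 k.+1 hs (leq0n _) => /=; lia.
by rewrite IH // s0; case: i => [|i] //=; lia.
Qed.

(** Moving bead [a] to the vacant position [y] and sorting again gives the row lengths of a smaller
    partition; the skew diagram in between is checked to be a strip. *)
Lemma border_strip_of_bead p l lam a : (0 < p)%N -> is_partition lam -> (size lam <= l)%N ->
  (a < l)%N -> (p <= bead l lam a)%N -> (bead l lam a - p)%N \notin beads l lam ->
  exists nu, border_strip p lam nu.
Proof.
move=> p0 lamP sl al pa; set y := (bead l lam a - p)%N => yn.
pose L := nth 0%N lam; have Ld i j := @weakly_decr_nth lam i j (partition_decr lamP).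
have Ls i : (0 < L i)%N -> (i < size lam)%N.
  by rewrite ltnNge /L; case: (ltnP i (size lam)) => // h; rewrite nth_default.
have L0 i : (l <= i)%N -> L i = 0%N.
  by move=> h; rewrite /L nth_default // (leq_trans sl).
have nE i : bead l lam i = (L i + (l - i.+1))%N by [].
have yne i : (i < l)%N -> bead l lam i != y.
  by move=> il; apply: contra yn => /eqP <-; apply: map_f; rewrite mem_iota.
have ex : exists i, ((i < l) && (y < bead l lam i))%N by exists a; rewrite al /y; lia.
have bound i : ((i < l) && (y < bead l lam i))%N -> (i <= l)%N by case/andP => /ltnW.
case: (ex_maxnP ex bound) => b /andP[bl yb] bmax.
have ab : (a <= b)%N by apply: bmax; rewrite al /y; lia.
(* As [y] is vacant, the bead after [b] lies strictly below [y]; hence the new row [b] has an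
   untruncated length, at least that of row [b + 1]. *)
have yb1 : (l - b.+1 <= y)%N /\ (L b.+1 + (l - b.+1) <= y)%N.
  have [b1l|lb1] := ltnP b.+1 l; last by rewrite L0 //; lia.
  have : (bead l lam b.+1 < y)%N.
    rewrite ltn_neqAle yne // leqNgt; apply/negP => h.
    by have := bmax b.+1; rewrite b1l h => /(_ isT); rewrite ltnn.
  by rewrite nE; lia.
have Lb : (0 < L b)%N by move: yb; rewrite nE; lia.
(* Rows [a] to [b - 1] inherit the bead of the next row, which costs one cell; row [b] gets the
   length that puts its bead at [y]. *)
pose N i := if (i < a)%N then L i else if (i < b)%N then (L i.+1).-1
  else if i == b then (y - (l - b.+1))%N else L i.
have Na i : (i < a)%N -> N i = L i by rewrite /N => ->.
have Nab i : (a <= i < b)%N -> N i = (L i.+1).-1 by rewrite /N => /andP[h1 h2]; rewrite ltnNge h1 h2.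
have Nb : N b = (y - (l - b.+1))%N by rewrite /N ltnn eqxx ltnNge ab.
have Nbl i : (b < i)%N -> N i = L i.
  by rewrite /N => h; case: eqP => [?|_]; [lia|case: ltnP => //; case: ltnP => //; lia].
have Nb_lt : (N b < L b)%N by move: yb; rewrite Nb nE; lia.
have Nb_ge : (L b.+1 <= N b)%N by rewrite Nb; lia.
have Lpos i : (i <= b)%N -> (0 < L i)%N by move=> ib; apply: leq_trans Lb _; apply: Ld.
have cases i : [\/ (i < a)%N, (a <= i < b)%N, i = b | (b < i)%N].
  case: (ltnP i a) => h1; first by constructor 1.
  by case: (ltngtP i b) => h2; [constructor 2|constructor 4|constructor 3].
have NL i : (N i <= L i)%N.
  case: (cases i) => [/Na ->//|/Nab ->|->|/Nbl ->//]; last exact: ltnW.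
  by have := Ld i i.+1 (leqnSn i); rewrite -!/(L _); lia.
have Ndecr i : (N i.+1 <= N i)%N.
  have := Ld i i.+1 (leqnSn i); rewrite -!/(L _) => h0; have := NL i.+1.
  case: (cases i) => h; first by rewrite [N i]Na //; lia.
  - rewrite [N i]Nab // => _; case: (cases i.+1) => h2; try lia.
      by rewrite Nab //; have := Ld i.+1 i.+2 (leqnSn _); rewrite -!/(L _); lia.
    by rewrite h2; lia.
  - by rewrite h [N b.+1]Nbl.
  by rewrite !Nbl //; lia.
pose nu := [seq x <- mkseq N (size lam) | (0 < x)%N].
have mk : weakly_decr (mkseq N (size lam)).
  apply/(sortedP 0%N) => i; rewrite size_mkseq => h; rewrite !nth_mkseq //; lia.
have nuE i : nth 0%N nu i = N i.
  rewrite /nu filter_pos_nth //; case: (ltnP i (size lam)) => h; first by rewrite nth_mkseq.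
  rewrite nth_default ?size_mkseq //; have := NL i; rewrite /L [nth _ lam i]nth_default //; lia.
have nuP : is_partition nu.
  by rewrite /is_partition sorted_filter ?filter_all //; apply: geq_trans.
have szn : (size nu <= size lam)%N by rewrite size_filter -{2}(size_mkseq N (size lam)) count_size.
have sd : subdiagram nu lam.
  by rewrite /subdiagram szn; apply/allP => i _; rewrite nuE; apply: NL.
have mem i c : ((i, c) \in skew_cells lam nu) = (N i <= c < L i)%N by rewrite mem_skew_cells nuE.
have rowin i c : (i, c) \in skew_cells lam nu -> (a <= i <= b)%N.
  by rewrite mem; case: (cases i) => [h|h|->|h]; [rewrite Na //| | |rewrite Nbl //]; lia.
have lead i : (a <= i <= b)%N -> (i, N i) \in skew_cells lam nu.
  move=> h; rewrite mem leqnn; case: (cases i) => h2; try lia; last by rewrite h2.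
  rewrite Nab //; have := Ld i i.+1 (leqnSn _); have := Lpos i.+1; rewrite -!/(L _); lia.
have bn i : bead l nu i = (N i + (l - i.+1))%N by rewrite /bead nuE.
exists nu; split => //.
  have [|i hi|i hi|s1 [s2 [s3 [e1 e2 e3]]]] := @beads_split l lam nu a b ab bl.
  - by move=> i h; rewrite bn Na.
  - by rewrite bn Nab // nE; have := Lpos i.+1; lia.
  - by rewrite bn Nbl //; lia.
  have := sumn_beads (leq_trans szn sl); have := sumn_beads sl; rewrite (sumn_skew sd).
  by rewrite e1 e2 !sumn_cat /= !sumn_cat /= bn Nb /y; lia.
split; last first.
  (* The part of row [i + 1] in the strip ends in the column [N i] where that of row [i] starts. *)
  move=> i j; apply/negP; rewrite !mem => /and4P[h1 h2 h3 h4].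
  have r1 : (a <= i <= b)%N by apply: (rowin i j); rewrite mem.
  have r2 : (a <= i.+1 <= b)%N by apply: (rowin i.+1 j); rewrite mem.
  by move: h1; rewrite Nab; lia.
(* Connectedness: every cell walks left to the first cell of its row, then down to the next row,
   until it reaches [(b, N b)]. *)
have left i c : (i, c) \in skew_cells lam nu -> reach (skew_cells lam nu) (i, c) (i, N i).
  move=> ic; have : (N i <= c)%N by move: ic; rewrite mem => /andP[].
  elim: c ic => [|c IH] ic; first by rewrite leqn0 => /eqP ->; exists [::].
  rewrite leq_eqVlt => /predU1P[->|h]; first by exists [::].
  have ic' : (i, c) \in skew_cells lam nu by move: ic; rewrite !mem; lia.
  apply: reach_trans (IH ic' h); exists [:: (i, c)].
  by rewrite /= ic' /cell_adj /= !eqxx /= ?orbT.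
have base i c : (i, c) \in skew_cells lam nu -> reach (skew_cells lam nu) (i, c) (b, N b).
  move=> ic; have r := rowin _ _ ic; apply: reach_trans (left _ _ ic) _.
  have := subnKC (proj2 (andP r)); move: (b - i)%N => k {ic c}.
  elim: k i r => [|k IH] i r e; first by have -> : i = b by [lia]; exists [::].
  have ib : (i < b)%N by lia.
  have h : (i.+1, N i) \in skew_cells lam nu.
    rewrite mem Ndecr Nab; last by lia.
    by have := Lpos i.+1 ib; lia.
  apply: (@reach_trans _ _ (i.+1, N i)).
    exists [:: (i.+1, N i)]; by rewrite /= h /cell_adj /= !eqxx /= ?orbT.
  by apply: reach_trans (left _ _ h) _; apply: IH; lia.
by move=> [i c] [j d] ic jd; apply: (reach_trans (base _ _ ic)); apply: reach_sym (base _ _ jd).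
Qed.

(** * Signs and the core *)

Definition res_inv (p u v : nat) : nat := ((u < v) && (v %% p < u %% p))%N.

(* Counts the pairs whose order changes between sorting by value and sorting by
   (residue mod p, value). *)
Definition inversions (p : nat) (s : seq nat) : nat :=
  (\sum_(u <- s) \sum_(v <- s) res_inv p u v)%N.

Lemma inversions_perm p s t : perm_eq s t -> inversions p s = inversions p t.
Proof.
by move=> st; rewrite /inversions (perm_big _ st); apply: eq_bigr => u _; apply: perm_big.
Qed.

Lemma inversions_cons p x s :
  inversions p (x :: s) = (\sum_(v <- s) (res_inv p x v + res_inv p v x) + inversions p s)%N.
Proof.
rewrite /inversions !big_cons {1}/res_inv ltnn add0n.
under [X in (_ + X)%N]eq_bigr => v _ do rewrite big_cons.
by rewrite !big_split /= addnA.
Qed.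

Lemma odd_sum (s : seq nat) (F : nat -> nat) b : {in s, forall v, odd (F v) = b} ->
  odd (\sum_(v <- s) F v)%N = b && odd (size s).
Proof.
elim: s => [|a s IH] h; first by rewrite big_nil andbF.
rewrite big_cons oddD h ?mem_head // IH; last by move=> v vs; apply: h; rewrite inE vs orbT.
by case: b {IH h} => //=.
Qed.

(** The sliding bead keeps its residue, so only its order relative to the beads strictly between
    [x - p] and [x] changes. Those have another residue, being closer than [p], so each changes the
    count by one. *)
Lemma inversions_slide p s1 x s2 s3 : (0 < p)%N -> (p <= x)%N ->
  sorted (fun a b => b < a)%N (s1 ++ x :: s2 ++ s3) ->
  sorted (fun a b => b < a)%N (s1 ++ s2 ++ (x - p)%N :: s3) ->
  odd (inversions p (s1 ++ x :: s2 ++ s3) + inversions p (s1 ++ s2 ++ (x - p)%N :: s3))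
  = odd (size s2).
Proof.
move=> p0 px; have tr : transitive (fun a b : nat => b < a)%N by move=> u v w; lia.
rewrite !(sorted_pairwise tr) !pairwise_cat /= => /and3P[/allrelP a1 _ /andP[b1 _]].
move=> /and3P[_ _ /and3P[/allrelP a3 _ /andP[b3 _]]].
set y := (x - p)%N.
have P1 : perm_eq (s1 ++ x :: s2 ++ s3) (x :: s1 ++ s2 ++ s3).
  by rewrite -(cat1s x (s2 ++ s3)) perm_catCA.
have P2 : perm_eq (s1 ++ s2 ++ y :: s3) (y :: s1 ++ s2 ++ s3).
  by rewrite -(cat1s y s3) catA perm_catCA -catA.
rewrite (inversions_perm p P1) (inversions_perm p P2) !inversions_cons addnACA -big_split /=.
(* Pairs that avoid the moving bead occur in both counts and cancel mod 2. *)
rewrite addnn oddD odd_double addbF !big_cat /= !oddD.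
have yx : (y %% p = x %% p)%N by rewrite -[in RHS](subnK px) modnDr.
rewrite (@odd_sum s1 _ false) => [|v vs]; last first.
  have := a1 v x vs (mem_head _ _); rewrite /res_inv yx; move: (v %% p)%N (x %% p)%N; lia.
rewrite (@odd_sum s3 _ false) => [|v vs]; last first.
  have := allP b3 v vs; rewrite /res_inv yx; move: (v %% p)%N (x %% p)%N; lia.
rewrite (@odd_sum s2 _ true) => [|v vs]; first by rewrite addbF.
have vx : (v < x)%N by apply: (allP b1); rewrite mem_cat vs.
have yv : (y < v)%N by apply: a3 => //; apply: mem_head.
have ne : (x %% p)%N != (v %% p)%N.
  apply/negP; rewrite eqn_mod_dvd ?(ltnW vx) // => /dvdn_leq; lia.
by move: ne; rewrite /res_inv yx; move: (v %% p)%N (x %% p)%N; lia.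
Qed.

Lemma beads_sorted l s : weakly_decr s -> sorted (fun a b => b < a)%N (beads l s).
Proof.
move=> hs; apply/(sortedP 0%N) => i; rewrite size_map size_iota => il.
by rewrite !(nth_map 0%N) ?size_iota ?(ltnW il) // !nth_iota ?(ltnW il) // bead_lt.
Qed.

(** A slide by [p] keeps residues, and the parities of [inversions_slide] telescope along the
    chain. *)
Lemma strip_chain_beads p l lam core h : (0 < p)%N -> strip_chain p lam core h ->
  is_partition lam -> (size lam <= l)%N ->
  [/\ is_partition core, (size core <= l)%N,
      perm_eq [seq (x %% p)%N | x <- beads l core] [seq (x %% p)%N | x <- beads l lam] &
      odd (inversions p (beads l lam) + inversions p (beads l core)) = odd h].
Proof.
move=> p0; elim=> [s|s nu c k strip chain IH] sP sl; first by split => //; rewrite addnn odd_double.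
have [_ nuP /andP[sz _] _ _] := strip.
have [cP cl pe od] := IH nuP (leq_trans sz sl).
have [s1 [s2 [s3 [x [px e1 e2 e3]]]]] := border_strip_beads p0 strip sl.
have h1 := beads_sorted l (partition_decr sP); have h2 := beads_sorted l (partition_decr nuP).
rewrite e1 in h1; rewrite e2 in h2; have := inversions_slide p0 px h1 h2.
rewrite -e1 -e2 e3 => od2; split => //; last first.
  by rewrite [RHS]oddD -od -od2 !oddD addbA addbK.
apply: (perm_trans pe); rewrite e1 e2 !map_cat /= !map_cat /= -(modnDr (x - p)%N) subnK //.
by rewrite perm_cat2l -(cat1s _ [seq (x %% p)%N | x <- s3]) perm_catCA.
Qed.

(** Without removable strips every runner is filled from the bottom, so the residues alone determine
    the beads; an inclusion between sets of the same size suffices. *)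
Lemma core_beads p l core (n : nat -> nat) : (0 < p)%N -> is_partition core -> (size core <= l)%N ->
  (forall nu, ~ border_strip p core nu) ->
  perm_eq [seq (x %% p)%N | x <- beads l core] [seq (n i %% p)%N | i <- iota 0 l] ->
  perm_eq (beads l core) [seq core_bead p n j | j <- iota 0 l].
Proof.
move=> p0 cP cl nostrip pe.
have closed x : x \in beads l core -> (p <= x)%N -> (x - p)%N \in beads l core.
  move=> /mapP[a]; rewrite mem_iota => al -> px; apply/negPn/negP => h.
  have [nu] := border_strip_of_bead p0 cP cl (proj2 (andP al)) px h; exact: nostrip.
have uC : uniq (beads l core).
  by apply: sorted_uniq (beads_sorted l (partition_decr cP)) => [u v w|u]; rewrite ?ltnn //; lia.
have runner x k : x \in beads l core -> (k <= x %/ p)%N -> (p * k + x %% p)%N \in beads l core.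
  move=> xb kx; rewrite -(subKn kx); elim: (x %/ p - k)%N (leq_subr k (x %/ p)) => [|d IH] dx.
    by rewrite subn0 mulnC -divn_eq.
  have := closed _ (IH (ltnW dx)); have -> : (p * (x %/ p - d) + x %% p - p = p * (x %/ p - d.+1) + x %% p)%N.
    by rewrite -(subnSK dx) mulnS -addnA addKn.
  by apply; rewrite -(subnSK dx) mulnS -addnA leq_addr.
have sub : {subset beads l core <= [seq core_bead p n j | j <- iota 0 l]}.
  move=> x xb; have [|j jl <-] := @core_bead_onto p n l x p0; last by apply: map_f; rewrite mem_iota.
  (* The levels [0, ..., x %/ p] of the runner of [x] are all occupied, which bounds its number of
     beads from below. *)
  have -> : count (fun i => n i %% p == x %% p)%N (iota 0 l) = count (fun y => y %% p == x %% p)%N (beads l core).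
    by have := seq.permP pe (pred1 (x %% p)%N); rewrite !count_map.
  rewrite -size_filter -(size_iota 0 (x %/ p).+1) -(size_map (fun k => (p * k + x %% p)%N)).
  apply: uniq_leq_size; first by rewrite map_inj_uniq ?iota_uniq // => u v /addIn/eqP; rewrite eqn_pmul2l // => /eqP.
  move=> y /mapP[k]; rewrite mem_iota add0n ltnS => kx ->.
  by rewrite mem_filter mulnC modnMDl modn_mod eqxx mulnC runner.
have [|_ e] := uniq_min_size uC sub; first by rewrite !size_map.
apply: uniq_perm => //; rewrite map_inj_uniq ?iota_uniq //; exact: core_bead_inj.
Qed.

(** The absolute value of the Vandermonde product for distinct entries. It is insensitive to order,
    so it can be computed on either enumeration of the core beads. *)
Definition distances (s : seq nat) : nat :=
  (\prod_(u <- s) \prod_(v <- s) (if v < u then u - v else 1))%N.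

Lemma distances_perm s t : perm_eq s t -> distances s = distances t.
Proof.
by move=> st; rewrite /distances (perm_big _ st); apply: eq_bigr => u _; apply: perm_big.
Qed.

Lemma distances_map (f : nat -> nat) l :
  distances [seq f i | i <- iota 0 l]
  = (\prod_(j < l) \prod_(i < j) (if f i == f j then 1 else (f j - f i) + (f i - f j)))%N.
Proof.
rewrite /distances big_map -{1}(subn0 l) big_mkord.
under eq_bigr => j _ do rewrite big_map -{1}(subn0 l) big_mkord.
rewrite (big_square muln (fun i j => if f i < f j then f j - f i else 1)%N) /=.
rewrite [X in (_ * X)%N]big1 ?muln1 => [|j _]; last by rewrite ltnn.
by apply: eq_bigr => j _; apply: eq_bigr => i _; case: ltngtP; lia.
Qed.

Lemma inversions_map p (f : nat -> nat) l :
  inversions p [seq f i | i <- iota 0 l]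
  = (\sum_(j < l) \sum_(i < j) (res_inv p (f i) (f j) + res_inv p (f j) (f i)))%N.
Proof.
rewrite /inversions big_map -{1}(subn0 l) big_mkord.
under eq_bigr => j _ do rewrite big_map -{1}(subn0 l) big_mkord.
rewrite (big_square addn (fun i j => res_inv p (f j) (f i))) /=.
rewrite [X in (_ + X)%N]big1 ?addn0 => [|j _]; last by rewrite /res_inv ltnn.
by apply: eq_bigr => j _; apply: eq_bigr => i _; rewrite addnC.
Qed.

Lemma big_beads (R : Type) (idx : R) (op : Monoid.law idx) (f : nat -> nat) (F : nat -> R) l :
  \big[op/idx]_(x <- [seq f i | i <- iota 0 l]) F x = \big[op/idx]_(j < l) F (f j).
Proof. by rewrite big_map -{1}(subn0 l) big_mkord. Qed.

Lemma hook_prod_distances s l : weakly_decr s -> (size s <= l)%N ->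
  (hook_prod s * distances (beads l s) = \prod_(x <- beads l s) x`!)%N.
Proof.
move=> hs sl; have := hook_prod_beads predT hs sl; rewrite -/(hook_prod s) => H.
rewrite /beads distances_map (big_beads _ (bead l s)).
transitivity (\prod_(i < l) \prod_(1 <= h < (bead l s i).+1) h)%N.
  rewrite -H; congr (_ * _)%N; apply: eq_bigr => j _; apply: eq_bigr => i _.
  by have := bead_lt hs (ltn_ord i) (ltn_ord j); case: ltngtP => //; lia.
by apply: eq_bigr => i _; rewrite fact_prod.
Qed.

Lemma hook_prod_nonp_beads p s l : weakly_decr s -> (size s <= l)%N ->
  (hook_prod_nonp p s *
    \prod_(j < l) \prod_(i < j | (bead l s i %% p != bead l s j %% p)%N) (bead l s i - bead l s j)
   = \prod_(j < l) nonp_fact p (bead l s j))%N.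
Proof.
move=> hs sl; rewrite /nonp_fact -(hook_prod_beads (fun h => ~~ (p %| h)%N) hs sl).
congr (_ * _)%N; apply: eq_bigr => j _; apply: eq_bigl => i.
by rewrite eqn_mod_dvd // ltnW // bead_lt.
Qed.

(* Each pair [i < j] contributes the sign of [C_j - C_i], and also that of [n_j - n_i] when the
   residues differ; these are the parities counted by [inversions]. *)
Lemma vdm_core_sign p l n : (0 < p)%N ->
  (forall i j, (i < j)%N -> (j < l)%N -> (n j < n i)%N) ->
  vdm l (core_bead p n) /
    \prod_(j < l) \prod_(i < j | (n i %% p != n j %% p)%N) ((n j)%:R - (n i)%:R) =
  (-1) ^+ (inversions p [seq n i | i <- iota 0 l]
           + inversions p [seq core_bead p n i | i <- iota 0 l]) *
  (distances [seq core_bead p n i | i <- iota 0 l])%:R /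
  (\prod_(j < l) \prod_(i < j | (n i %% p != n j %% p)%N) (n i - n j))%N%:R :> rat.
Proof.
move=> p0 nd; set C := core_bead p n.
have Cm j : (C j %% p = n j %% p)%N by apply: core_bead_mod.
rewrite !inversions_map distances_map /vdm -big_split /=.
rewrite !natr_prod -prodrXr -big_split -!prodf_div; apply: eq_bigr => j _ /=.
rewrite -big_split natr_prod natr_prod -prodrXr -big_split /=.
rewrite [X in _ / X = _]big_mkcond [X in _ = _ / X]big_mkcond -!prodf_div.
apply: eq_bigr => i _ /=; have ij := ltn_ord i; have nij := nd _ _ ij (ltn_ord j).
have Cij : C i != C j by apply/eqP => /core_bead_inj - /(_ p0) e; rewrite e ltnn in ij.
rewrite (negbTE Cij) /res_inv !Cm (ltnNge (n i)) (ltnW nij) nij /=.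
(* On a common runner the core beads increase with the index, so [C j - C i] is positive and there
   is no inversion. *)
have [e|ne] := eqVneq (n i %% p)%N (n j %% p)%N.
  have Clt : (C i < C j)%N.
    by rewrite /C /core_bead e ltn_add2r ltn_pmul2l //; apply: occ_lt.
  by rewrite e !ltnn !andbF /= expr0 mul1r !divr1 (eqP (ltnW Clt : _ == _)) addn0 natrB // ltnW.
have d0 : (n i - n j)%:R != 0 :> rat by rewrite pnatr_eq0 subn_eq0 -ltnNge.
have -> : (n j)%:R - (n i)%:R = - (n i - n j)%:R :> rat by rewrite natrB ?opprB // ltnW.
rewrite invrN mulrN -mulNr opprB; congr (_ / _).
case: (ltngtP (C i) (C j)) Cij => // Cij _;
  case: (ltngtP (n i %% p)%N (n j %% p)%N) ne => // rij _;
  rewrite /= ?addn0 ?add0n ?expr1 ?expr0 ?mul1r ?mulN1r ?sqrrN ?expr1n ?mul1r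
    ?(natrB _ (ltnW Cij)) ?opprB //.
- by have -> : (C j - C i + (C i - C j) = C j - C i)%N by [lia]; rewrite natrB ?opprB // ltnW.
- by have -> : (C j - C i + (C i - C j) = C j - C i)%N by [lia]; rewrite natrB ?opprB // ltnW.
- by have -> : (C j - C i + (C i - C j) = C i - C j)%N by [lia]; rewrite natrB // ltnW.
by have -> : (C j - C i + (C i - C j) = C i - C j)%N by [lia]; rewrite natrB // ltnW.
Qed.

(** * The factorization of [q_lam] and its constant coefficient in terms of hooks *)

Lemma wronskianE fs l : size fs = l ->
  wronskian fs = \det (\matrix_(i < l, j < l) (nth 0 fs j)^`(i)).
Proof. by move=> <-. Qed.

Lemma DeltaE (f : nat -> nat) l : Delta [seq f i | i <- iota 0 l] = vdm l f.
Proof.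
rewrite /Delta size_map size_iota (exchange_big_dep predT) //=.
apply: eq_bigr => j _; rewrite (big_ord_widen_cond l predT (fun i => (f j)%:R - (f i)%:R)) ?(ltnW (ltn_ord j)) //.
apply: eq_bigr => i _; rewrite !(nth_map 0%N) ?size_iota // !nth_iota // !add0n.
by rewrite rmorphB /= !pmulrn.
Qed.

Theorem theorem7p2 (p : nat) (lam core : seq nat) (ht : nat) :
  (2 <= p)%N ->
  is_partition lam ->
  strip_chain p lam core ht ->
  (forall nu, ~ border_strip p core nu) ->
  exists R : {poly rat},
    [/\ q_lam p lam = 'X^(sumn core) * (R \Po 'X^p),
        R \is monic,
        size R = (quot_size p lam).+1,
        R.[0] != 0
      & R.[0] = (-1) ^+ (ht + (sumn lam - sumn core) %/ p)
                * (hook_prod_nonp p lam)%:R / (hook_prod core)%:R].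
Proof.
move=> p2 lamP chain nostrip; have p0 : (0 < p)%N by apply: ltnW.
pose l := size lam; pose n := bead l lam; pose C := core_bead p n.
have lamD := partition_decr lamP.
have [coreP core_l res_eq parity] := strip_chain_beads p0 chain lamP (leqnn l).
have coreD := partition_decr coreP.
have coreE : perm_eq (beads l core) [seq C j | j <- iota 0 l].
  by apply: core_beads => //; move: res_eq; rewrite -[X in perm_eq _ X]map_comp.
have n_inj i j : (i < l)%N -> (j < l)%N -> n i = n j -> i = j by apply: bead_inj.
(* Any common bound on the quotients [n j %/ p] would do. *)
pose K := (\sum_(j < l) n j).+1.
have nK j : (j < l)%N -> (n j %/ p < K)%N.
  move=> jl; rewrite ltnS (leq_trans (leq_div _ _)) //.
  by rewrite (bigD1 (Ordinal jl)) //= leq_addr.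
have tri : (\sum_(j < l) (l - j.+1) = \sum_(j < l) j)%N.
  by rewrite (reindex_inj rev_ord_inj); apply: eq_bigr => j _ /=; have := ltn_ord j; lia.
have sumC : (\sum_(j < l) C j = sumn core + \sum_(j < l) j)%N.
  by rewrite -tri -(sumn_beads core_l) (perm_sumn coreE) sumnE (big_beads _ C).
(* Identifies [Rdeg] with the second term of the sign exponent, the number of strips removed. *)
have sumlam : (sumn lam = sumn core + p * Rdeg p l n)%N.
  have := sumn_beads (leqnn l : (size lam <= l)%N); rewrite sumnE (big_beads _ n) tri.
  by rewrite -(sum_core_bead_n p0 n_inj) sumC => H; lia.
have Rmonic := Rpoly_lead p0 n_inj (ltn0Sn _ : 0 < K)%N.
have hooks_core := hook_prod_distances coreD core_l.
have hooks_lam := hook_prod_nonp_beads p lamD (leqnn l).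
have hooks_core_pos : (0 < hook_prod core * distances (beads l core))%N.
  by rewrite hooks_core prodn_gt0 // => x; apply: fact_gt0.
have hooks_lam_pos : (0 < \prod_(j < l) nonp_fact p (n j))%N.
  rewrite prodn_gt0 // => j; have := fact_gt0 (n j); rewrite (fact_nonp _ p0).
  by rewrite muln_gt0 => /andP[].
move: (hooks_lam_pos) (hooks_core_pos); rewrite -hooks_lam !muln_gt0 => /andP[hl0 dl0] /andP[hc0 dc0].
have R0 : (Rpoly p l K n).[0] = (-1) ^+ (ht + (sumn lam - sumn core) %/ p)
                * (hook_prod_nonp p lam)%:R / (hook_prod core)%:R.
  rewrite (Rpoly_const p0 n_inj nK) sumlam addKn mulKn //.
  have n_decr i j : (i < j)%N -> (j < l)%N -> (n j < n i)%N by apply: bead_lt.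
  have sgn := vdm_core_sign p0 n_decr.
  (* Only the parity of the inversions matters, and along the strip chain it is that of [ht]. *)
  rewrite -(distances_perm coreE) -(inversions_perm p coreE) -signr_odd parity signr_odd in sgn.
  have prodC : \prod_(j < l) (core_bead p n j)`!%:R
             = (hook_prod core)%:R * (distances (beads l core))%:R :> rat.
    by rewrite -natrM hooks_core (perm_big _ coreE) /= (big_beads _ C) natr_prod.
  have prodN := congr1 (fun m => m%:R : rat) hooks_lam; rewrite natrM [in RHS]natr_prod -/n in prodN.
  (* Regroups the factors around the quotient evaluated by [vdm_core_sign]; the bead distances then
     cancel, leaving the hook products. *)
  transitivity ((-1) ^+ Rdeg p l n *
    (vdm l (core_bead p n) / \prod_(j < l) \prod_(i < j | (n i %% p != n j %% p)%N) ((n j)%:R - (n i)%:R)) *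
    (\prod_(j < l) (nonp_fact p (n j))%:R / \prod_(j < l) (core_bead p n j)`!%:R)); first by ring.
  rewrite sgn prodC -prodN exprD.
  have := hc0; have := dc0; have := dl0; rewrite !lt0n -!(pnatr_eq0 rat) -/n => h1 h2 h3.
  by field; rewrite h1 h2 h3.
exists (Rpoly p l K n); have [Rm Rs] := Rmonic; split => //.
- rewrite /q_lam -[degvec lam]/[seq n i | i <- iota 0 l] DeltaE.
  rewrite (@wronskianE _ l) ?size_map ?size_iota //.
  have -> : sumn core = (\sum_(j < l) C j - \sum_(j < l) j)%N by rewrite sumC addnK.
  rewrite -(Rpoly_wronskian p0 n_inj nK); congr (_ *: \det _); apply/matrixP => i j; rewrite !mxE.
  by rewrite -map_comp (nth_map 0%N) ?size_iota // nth_iota.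
- by rewrite (quot_size_beads p0 lamD).
rewrite R0 !mulf_neq0 ?invr_eq0 ?signr_eq0 ?pnatr_eq0 -?lt0n //.
Qed.
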